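(* Let $k$ be an algebraically closed field of characteristic not two. (1) Let $R=k[\![x,y]\!]/(x^2)$. For all integers $a,b\ge 0$, the ideal $(x,y^a)R$ degenerates to the ideal $(x,y^b)R$ (as $R$-modules) if and only if $a\le b$ and $a\equiv b \pmod 2$. (2) Let $R=k[\![x,y,z]\!]/(xy)$. For all integers $0\le a<b$, the ideal $(x,z^a)R$ does not degenerate to $(x,z^b)R$, and the ideal $(y,z^a)R$ does not degenerate to $(y,z^b)R$ (as $R$-modules).
   Context: Degeneration: let $R$ be a noetherian algebra over a field $k$ and let $M,N$ be finitely generated $R$-modules. We say that $M$ degenerates to $N$ if there exist a discrete valuation ring $V$ that is a $k$-algebra, with maximal ideal $tV$ and residue field $k$, and a finitely generated $R\otimes_k V$-module $Q$ such that $Q$ is flat as a $V$-module, $Q/tQ\cong N$ as $R$-modules, and $Q_t\cong M\otimes_k V_t$ as $R\otimes_k V_t$-modules (subscript $t$ denotes inverting $t$). Here $y^0=z^0=1$, so for exponent $0$ the ideals are $R$ itself. *)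

(* Defs.v *)
From HB Require Import structures.
From mathcomp Require Import all_boot all_algebra.
From mathcomp Require Import generic_quotient ring_quotient boolp.
From mathcomp.multinomials Require Import mpoly.
From mathcomp Require Import zify.

Set Implicit Arguments.
Unset Strict Implicit.
Unset Printing Implicit Defensive.

Import GRing.Theory.
Local Open Scope ring_scope.
Local Open Scope quotient_scope.

(* Restriction of scalars: the B-module M seen as an A-module along f. *)
Definition restrict_sort (A B : pzRingType) (f : {rmorphism A -> B})
  (M : lmodType B) : Type := M.

Section Restriction.
Variables (A B : pzRingType) (f : {rmorphism A -> B}) (M : lmodType B).
Local Notation rM := (restrict_sort f M).

HB.instance Definition _ := GRing.Zmodule.on rM.

Let rscale (a : A) (m : rM) : rM := f a *: (m : M).

Fact rscaleA a b m : rscale a (rscale b m) = rscale (a * b) m.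
Proof. by rewrite /rscale scalerA rmorphM. Qed.
Fact rscale1 : left_id 1 rscale.
Proof. by move=> m; rewrite /rscale rmorph1 scale1r. Qed.
Fact rscaleDr : right_distributive rscale +%R.
Proof. by move=> a m m'; rewrite /rscale scalerDr. Qed.
Fact rscaleDl m : {morph rscale^~ m : a b / a + b}.
Proof. by move=> a b; rewrite /rscale rmorphD scalerDl. Qed.
HB.instance Definition _ :=
  GRing.Zmodule_isLmodule.Build A rM rscaleA rscale1 rscaleDr rscaleDl.

Definition restrict : lmodType A := GRing.Lmodule.clone A rM _.

Lemma rscaleE (a : A) (m : restrict) : a *: m = (f a *: (m : M) : restrict).
Proof. by []. Qed.
End Restriction.

Definition lmod_iso (A : pzRingType) (M N : lmodType A) : Prop :=
  exists f : {linear M -> N}, bijective f.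

Section Span.
Variables (A : pzRingType) (M : lmodType A).

Definition span (s : seq M) : pred M :=
  fun m => `[< exists c : 'I_(size s) -> A, m = \sum_(i < size s) c i *: s`_i >].

Fact span_submod s : subsemimod_closed (span s).
Proof.
split; last first.
  move=> a m /asboolP[c ->]; apply/asboolP; exists (fun i => a * c i).
  by rewrite scaler_sumr; apply: eq_bigr => i _; rewrite scalerA.
split; first by apply/asboolP; exists (fun=> 0); rewrite big1 // => i _; rewrite scale0r.
move=> m m' /asboolP[c ->] /asboolP[c' ->]; apply/asboolP.
exists (fun i => c i + c' i); rewrite -big_split.
by apply: eq_bigr => i _; rewrite scalerDl.
Qed.

Definition fin_gen : Prop := exists s : seq M, forall m, m \in span s.
End Span.

Section GeneratedIdeal.
Variables (R : comNzRingType) (s : seq R).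

Definition ideal_pred : pred R := @span R R^o s.

Fact ideal_pred_submod : subsemimod_closed (ideal_pred : {pred R^o}).
Proof. exact: (@span_submod R R^o). Qed.

Record ideal := Ideal { ideal_val :> R^o; _ : ideal_pred ideal_val }.
HB.instance Definition _ := [isSub for ideal_val].
HB.instance Definition _ := [Choice of ideal by <:].
HB.instance Definition _ :=
  GRing.SubChoice_isSubLmodule.Build R R^o ideal_pred ideal ideal_pred_submod.
End GeneratedIdeal.

(* The quotient P/(s) of a k-algebra; ideal quotients require (s) to be proper. *)
Section QuotientAlgebra.
Variables (k : comNzRingType) (P : comAlgType k) (s : seq P).
Hypothesis s_proper : 1 \notin ideal_pred s.

Definition proper_ideal_pred of 1 \notin ideal_pred s : pred P := ideal_pred s.
Local Notation I := (proper_ideal_pred s_proper).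

Fact proper_ideal_closed : idealr_closed I.
Proof.
have [[I0 ID] IZ] := ideal_pred_submod s.
by split=> // a u v uI vI; apply: ID => //; apply: (IZ a u).
Qed.
HB.instance Definition _ := isIdealr.Build P I proper_ideal_closed.

Local Notation J := (I : idealr P).

Definition quo_alg : Type := {ideal_quot J}.
HB.instance Definition _ := GRing.ComNzRing.on quo_alg.

Definition quo_pi (p : P) : quo_alg := \pi_{ideal_quot J} p.
Fact quo_piD p q : quo_pi (p + q) = quo_pi p + quo_pi q.
Proof. exact: (rmorphD \pi_{ideal_quot J}). Qed.
Fact quo_piM p q : quo_pi (p * q) = quo_pi p * quo_pi q.
Proof. exact: (rmorphM \pi_{ideal_quot J}). Qed.
Fact quo_pi1 : quo_pi 1 = 1.
Proof. exact: (rmorph1 \pi_{ideal_quot J}). Qed.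

Let qscale (c : k) (x : quo_alg) : quo_alg := quo_pi c%:A * x.
Fact qscaleA a b m : qscale a (qscale b m) = qscale (a * b) m.
Proof. by rewrite /qscale mulrA -quo_piM -scalerAl mul1r scalerA. Qed.
Fact qscale1 : left_id 1 qscale.
Proof. by move=> m; rewrite /qscale scale1r quo_pi1 mul1r. Qed.
Fact qscaleDr : right_distributive qscale +%R.
Proof. by move=> a m m'; rewrite /qscale mulrDr. Qed.
Fact qscaleDl m : {morph qscale^~ m : a b / a + b}.
Proof. by move=> a b; rewrite /qscale scalerDl quo_piD mulrDl. Qed.
HB.instance Definition _ :=
  GRing.Zmodule_isLmodule.Build k quo_alg qscaleA qscale1 qscaleDr qscaleDl.
Fact qscaleAl (a : k) (x y : quo_alg) : a *: (x * y) = (a *: x) * y.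
Proof. exact: mulrA. Qed.
HB.instance Definition _ := GRing.Lmodule_isLalgebra.Build k quo_alg qscaleAl.
HB.instance Definition _ := GRing.Lalgebra_isComAlgebra.Build k quo_alg.
End QuotientAlgebra.

(* M / aM *)
Section QuotientByElement.
Variables (A : comPzRingType) (a : A) (M : lmodType A).

Definition multiples : pred M := fun m => `[< exists m', m = a *: m' >].

Fact multiples_zmod : zmod_closed multiples.
Proof.
split; first by apply/asboolP; exists 0; rewrite scaler0.
move=> _ _ /asboolP[m ->] /asboolP[m' ->]; apply/asboolP.
by exists (m - m'); rewrite scalerBr.
Qed.
HB.instance Definition _ := GRing.isZmodClosed.Build M multiples multiples_zmod.
Let J := GRing.ZmodClosed.clone M multiples _.

Definition mod_elt : Type := Quotient.quot J.
HB.instance Definition _ := GRing.Zmodule.on mod_elt.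

Definition mod_pi (m : M) : mod_elt := \pi_(Quotient.quot J) m.
Fact mod_piD m m' : mod_pi (m + m') = mod_pi m + mod_pi m'.
Proof. exact: (raddfD \pi_(Quotient.quot J)). Qed.
Fact mod_pi_eq m m' : mod_pi m = mod_pi m' <-> exists m1, m - m' = a *: m1.
Proof.
split=> [/eqP|H]; first by rewrite -Quotient.idealrBE => /asboolP.
by apply/eqP; rewrite -Quotient.idealrBE; apply/asboolP.
Qed.

Let mscale (b : A) (x : mod_elt) : mod_elt := mod_pi (b *: (repr x : M)).
Fact mscaleE b m : mscale b (mod_pi m) = mod_pi (b *: m).
Proof.
apply/mod_pi_eq.
have /mod_pi_eq[m1 E] : mod_pi (repr (mod_pi m)) = mod_pi m by exact: reprK.
by exists (b *: m1); rewrite -scalerBr E !scalerA mulrC.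
Qed.
Fact mod_pi_surj x : exists m, x = mod_pi m.
Proof. by exists (repr x); rewrite /mod_pi reprK. Qed.
Fact mscaleA b c x : mscale b (mscale c x) = mscale (b * c) x.
Proof. by have [m ->] := mod_pi_surj x; rewrite !mscaleE scalerA. Qed.
Fact mscale1 : left_id 1 mscale.
Proof. by move=> x; have [m ->] := mod_pi_surj x; rewrite mscaleE scale1r. Qed.
Fact mscaleDr : right_distributive mscale +%R.
Proof.
move=> b x y; have [m ->] := mod_pi_surj x; have [m' ->] := mod_pi_surj y.
by rewrite -mod_piD !mscaleE scalerDr mod_piD.
Qed.
Fact mscaleDl x : {morph mscale^~ x : b c / b + c}.
Proof.
by move=> b c; have [m ->] := mod_pi_surj x; rewrite !mscaleE scalerDl mod_piD.
Qed.
HB.instance Definition _ :=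
  GRing.Zmodule_isLmodule.Build A mod_elt mscaleA mscale1 mscaleDr mscaleDl.
Lemma mod_piZ b m : b *: mod_pi m = mod_pi (b *: m).
Proof. exact: mscaleE. Qed.
End QuotientByElement.

(* M (x)_A N: formal finite sums of pairs (m, n), modulo the congruence
   generated by the bilinearity relations. *)
Section Tensor.
Variables (A : comPzRingType) (M N : lmodType A).

Inductive tens_eq : seq (M * N) -> seq (M * N) -> Prop :=
| TRefl s : tens_eq s s
| TSym s s' : tens_eq s s' -> tens_eq s' s
| TTrans s1 s2 s3 : tens_eq s1 s2 -> tens_eq s2 s3 -> tens_eq s1 s3
| TCat s1 s1' s2 s2' :
    tens_eq s1 s1' -> tens_eq s2 s2' -> tens_eq (s1 ++ s2) (s1' ++ s2')
| TSwap s1 s2 : tens_eq (s1 ++ s2) (s2 ++ s1)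
| TZero n : tens_eq [:: (0, n)] [::]
| TAddl m m' n : tens_eq [:: (m + m', n)] [:: (m, n); (m', n)]
| TAddr m n n' : tens_eq [:: (m, n + n')] [:: (m, n); (m, n')]
| TScale a m n : tens_eq [:: (a *: m, n)] [:: (m, a *: n)].

Definition tens_eqb : rel (seq (M * N)) := fun s s' => `[< tens_eq s s' >].
Fact tens_equiv : equiv_class_of tens_eqb.
Proof.
split=> [s|s s'|s2 s1 s3]; first exact/asboolP/TRefl.
  by apply/asboolP/asboolP; apply: TSym.
by move=> /asboolP h /asboolP h'; apply/asboolP; exact: TTrans h h'.
Qed.
Canonical tens_equiv_rel := EquivRelPack tens_equiv.
Canonical tens_encModRel := defaultEncModRel tens_eqb.

Definition tens : Type := {eq_quot tens_eqb}.
HB.instance Definition _ := Choice.on tens.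

Definition tens_cls (s : seq (M * N)) : tens := \pi_{eq_quot tens_eqb} s.
Definition tens_repr (x : tens) : seq (M * N) := repr (x : {eq_quot tens_eqb}).
Definition pure m n : tens := tens_cls [:: (m, n)].

Fact tens_clsP s s' : tens_cls s = tens_cls s' <-> tens_eq s s'.
Proof. by split=> [/eqmodP/asboolP|h]; last exact/eqmodP/asboolP. Qed.
Fact tens_reprK x : tens_cls (tens_repr x) = x.
Proof. exact: reprK. Qed.
Fact tens_reprP s : tens_eq (tens_repr (tens_cls s)) s.
Proof. by apply/tens_clsP; rewrite tens_reprK. Qed.

Let tzero : tens := tens_cls [::].
Let tadd (x y : tens) : tens := tens_cls (tens_repr x ++ tens_repr y).
Let topp (x : tens) : tens := tens_cls [seq (- p.1, p.2) | p <- tens_repr x].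

Let taddE s s' : tadd (tens_cls s) (tens_cls s') = tens_cls (s ++ s').
Proof. by apply/tens_clsP/TCat; apply: tens_reprP. Qed.
Fact taddA : associative tadd.
Proof.
move=> x y z; rewrite -(tens_reprK x) -(tens_reprK y) -(tens_reprK z).
by rewrite !taddE catA.
Qed.
Fact taddC : commutative tadd.
Proof. by move=> x y; apply/tens_clsP/TSwap. Qed.
Fact tadd0 : left_id tzero tadd.
Proof. by move=> x; rewrite -(tens_reprK x) taddE. Qed.
Fact taddN : left_inverse tzero topp tadd.
Proof.
move=> x; rewrite /topp -[x in tadd _ x]tens_reprK taddE; apply/tens_clsP.
elim: (tens_repr x) => [|[m n] s IHs] /=; first exact: TRefl.
have swap : tens_eq ([:: (- m, n)] ++ ([seq (- p.1, p.2) | p <- s] ++ [:: (m, n)]))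
    ([:: (- m, n)] ++ ([:: (m, n)] ++ [seq (- p.1, p.2) | p <- s])).
  by apply: TCat; [exact: TRefl | exact: TSwap].
have := TCat swap (TRefl s); rewrite /= -!catA /= => {}swap.
apply: TTrans swap _.
rewrite -[[:: _, _ & _]]/([:: (- m, n); (m, n)] ++ (_ ++ s)).
rewrite -[[::] in X in tens_eq _ X]/([::] ++ [::]); apply: TCat => //.
apply: TTrans (TSym (TAddl _ _ _)) _; rewrite addNr; exact: TZero.
Qed.
HB.instance Definition _ := GRing.isZmodule.Build tens taddA taddC tadd0 taddN.

Lemma tens_clsD s s' : tens_cls (s ++ s') = tens_cls s + tens_cls s'.
Proof. by rewrite -[RHS]/(tadd _ _) taddE. Qed.
Lemma tens_cls_sum s : tens_cls s = \sum_(p <- s) pure p.1 p.2.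
Proof.
elim: s => [|[m n] s IHs]; first by rewrite big_nil.
by rewrite big_cons -IHs -tens_clsD.
Qed.
Lemma tens_ind (P : tens -> Prop) :
    P 0 -> (forall x y, P x -> P y -> P (x + y)) -> (forall m n, P (pure m n)) ->
  forall x, P x.
Proof.
move=> P0 PD Pp x; rewrite -(tens_reprK x) tens_cls_sum.
by elim/big_ind: _ => // p _.
Qed.
Lemma pureDl m m' n : pure (m + m') n = pure m n + pure m' n.
Proof. by rewrite -tens_clsD; apply/tens_clsP/TAddl. Qed.
Lemma pureDr m n n' : pure m (n + n') = pure m n + pure m n'.
Proof. by rewrite -tens_clsD; apply/tens_clsP/TAddr. Qed.
Lemma pureZ a m n : pure (a *: m) n = pure m (a *: n).
Proof. exact/tens_clsP/TScale. Qed.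

(* The map m (x) n |-> f m n; meaningful when f is balanced biadditive. *)
Definition tens_lift (P : nmodType) (f : M -> N -> P) (x : tens) : P :=
  \sum_(p <- tens_repr x) f p.1 p.2.

Definition balanced (P : zmodType) (f : M -> N -> P) : Prop :=
  [/\ forall m m' n, f (m + m') n = f m n + f m' n,
      forall m n n', f m (n + n') = f m n + f m n'
    & forall a m n, f (a *: m) n = f m (a *: n)].

Section Lift.
Variables (P : zmodType) (f : M -> N -> P).
Hypothesis bf : balanced f.

Lemma tens_lift_cls s : tens_lift f (tens_cls s) = \sum_(p <- s) f p.1 p.2.
Proof.
have [fDl fDr fZ] := bf; rewrite /tens_lift.
suff sum_eq s1 s2 : tens_eq s1 s2 ->
    \sum_(p <- s1) f p.1 p.2 = \sum_(p <- s2) f p.1 p.2.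
  exact/sum_eq/tens_reprP.
elim=> {s s1 s2} //=.
- by move=> s1 s2 s3 _ -> _ ->.
- by move=> s1 s1' s2 s2' _ h _ h'; rewrite !big_cat /= h h'.
- by move=> s1 s2; rewrite !big_cat /= addrC.
- move=> n; rewrite big_seq1 big_nil /=.
  by apply: (addrI (f 0 n)); rewrite -fDl !addr0.
- by move=> m m' n; rewrite !big_cons !big_nil /= !addr0 fDl.
- by move=> m n n'; rewrite !big_cons !big_nil /= !addr0 fDr.
- by move=> a m n; rewrite !big_seq1 /= fZ.
Qed.
Lemma tens_lift_pure m n : tens_lift f (pure m n) = f m n.
Proof. by rewrite tens_lift_cls big_seq1. Qed.
Lemma tens_lift0 : tens_lift f 0 = 0.
Proof. by rewrite -[0]/(tens_cls [::]) tens_lift_cls big_nil. Qed.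
Lemma tens_liftD x y : tens_lift f (x + y) = tens_lift f x + tens_lift f y.
Proof.
rewrite -(tens_reprK x) -(tens_reprK y) -tens_clsD.
by rewrite !tens_lift_cls big_cat.
Qed.
End Lift.
End Tensor.

Definition tens_map (A : comPzRingType) (M X Y : lmodType A) (f : X -> Y) :
    tens M X -> tens M Y :=
  tens_lift (fun m x => pure m (f x)).

Definition flat (A : comPzRingType) (M : lmodType A) : Prop :=
  forall (X Y : lmodType A) (f : {linear X -> Y}),
    injective f -> injective (tens_map (M := M) f).

Section TensorSums.
Variables (A A' : comPzRingType) (M N : lmodType A) (M' N' : lmodType A').

Lemma balanced_lift (P : zmodType) (F : M -> N -> M' -> N' -> P) :
    (forall m' n', balanced (fun m n => F m n m' n')) ->
  forall y, balanced (fun m n => tens_lift (F m n) y).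
Proof.
move=> bF y; split=> [m m1 n|m n n1|a m n]; rewrite /tens_lift -?big_split /=;
  by apply: eq_bigr => p _; have [FDl FDr FZ] := bF p.1 p.2.
Qed.
End TensorSums.

Section TensorAlgebra.
Variables (k : comNzRingType) (R S : comAlgType k).

Definition tensA : Type := tens R S.
HB.instance Definition _ := GRing.Zmodule.on tensA.

Definition pureA (r : R) (s : S) : tensA := pure r s.

Let amul1 (r : R) (s : S) (r' : R) (s' : S) : tensA := pureA (r * r') (s * s').
Let amul (x y : tensA) : tensA := tens_lift (fun r s => tens_lift (amul1 r s) y) x.

Let amul1_balr r s : balanced (amul1 r s).
Proof.
split=> *; rewrite /amul1 /pureA ?mulrDr ?pureDl ?pureDr //.
by rewrite -!scalerAr pureZ.
Qed.
Let amul1_ball r' s' : balanced (fun r s => amul1 r s r' s').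
Proof.
split=> *; rewrite /amul1 /pureA ?mulrDl ?pureDl ?pureDr //.
by rewrite -!scalerAl pureZ.
Qed.
Let amul_bal y : balanced (fun r s => tens_lift (amul1 r s) y).
Proof. exact: balanced_lift. Qed.
Let amulE r s r' s' : amul (pureA r s) (pureA r' s') = pureA (r * r') (s * s').
Proof. by rewrite /amul !tens_lift_pure. Qed.
Fact amulDl : left_distributive amul +%R.
Proof. by move=> x y z; apply: tens_liftD. Qed.
Let amulDr : right_distributive amul +%R.
Proof.
move=> x y z; rewrite /amul {1 3 5}/tens_lift -big_split.
by apply: eq_bigr => p _; rewrite tens_liftD.
Qed.
Let amul0 x : amul x 0 = 0.
Proof. by apply: (addrI (amul x 0)); rewrite -amulDr !addr0. Qed.
Let amul0l x : amul 0 x = 0.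
Proof. by apply: (addrI (amul 0 x)); rewrite -amulDl !addr0. Qed.
Fact amulC : commutative amul.
Proof.
elim/tens_ind => [y|x x' IH IH' y|r s]; first by rewrite amul0 amul0l.
  by rewrite amulDl amulDr IH IH'.
elim/tens_ind => [|y y' IH IH'|r' s']; first by rewrite amul0 amul0l.
  by rewrite amulDl amulDr IH IH'.
by rewrite !amulE mulrC [s * _]mulrC.
Qed.
Fact amulA : associative amul.
Proof.
elim/tens_ind => [y z|x x' IH IH' y z|r s y z]; first by rewrite !amul0l.
  by rewrite !amulDl IH IH'.
elim/tens_ind: y => [|y y' IH IH'|r' s'].
- by rewrite amul0l amul0 amul0l.
- by rewrite !(amulDl, amulDr) IH IH'.
elim/tens_ind: z => [|z z' IH IH'|r1 s1]; first by rewrite !amul0.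
  by rewrite !amulDr IH IH'.
by rewrite !amulE !mulrA.
Qed.
Fact amul1l : left_id (pureA 1 1) amul.
Proof.
elim/tens_ind => [|x x' IH IH'|r s]; first by rewrite amul0.
  by rewrite amulDr IH IH'.
by rewrite amulE !mul1r.
Qed.
HB.instance Definition _ :=
  GRing.Zmodule_isComPzRing.Build tensA amulA amulC amul1l amulDl.

Lemma pureAM r s r' s' : pureA r s * pureA r' s' = pureA (r * r') (s * s').
Proof. exact: amulE. Qed.

Definition inl_alg (r : R) : tensA := pureA r 1.
Definition inr_alg (s : S) : tensA := pureA 1 s.
Fact inl_alg_zmod : zmod_morphism inl_alg.
Proof.
have D r r' : inl_alg (r + r') = inl_alg r + inl_alg r' by exact: pureDl.
by move=> r r'; apply: (addIr (inl_alg r')); rewrite -D !subrK.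
Qed.
Fact inl_alg_monoid : monoid_morphism inl_alg.
Proof. by split=> // r r'; rewrite pureAM mulr1. Qed.
HB.instance Definition _ := GRing.isZmodMorphism.Build R tensA inl_alg inl_alg_zmod.
HB.instance Definition _ := GRing.isMonoidMorphism.Build R tensA inl_alg inl_alg_monoid.
Fact inr_alg_zmod : zmod_morphism inr_alg.
Proof.
have D r r' : inr_alg (r + r') = inr_alg r + inr_alg r' by exact: pureDr.
by move=> r r'; apply: (addIr (inr_alg r')); rewrite -D !subrK.
Qed.
Fact inr_alg_monoid : monoid_morphism inr_alg.
Proof. by split=> // r r'; rewrite pureAM mulr1. Qed.
HB.instance Definition _ := GRing.isZmodMorphism.Build S tensA inr_alg inr_alg_zmod.
HB.instance Definition _ := GRing.isMonoidMorphism.Build S tensA inr_alg inr_alg_monoid.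

(* Commuting R- and S-actions on X that agree on k make X a module over
   R (x)_k S, by (r (x) s) x = r (s x). *)
Section Bimodule.
Variables (X : zmodType) (ra : R -> X -> X) (sa : S -> X -> X).

Record bimodule : Prop := Bimodule {
  raDl : forall r r' x, ra (r + r') x = ra r x + ra r' x;
  raDr : forall r x x', ra r (x + x') = ra r x + ra r x';
  raM : forall r r' x, ra r (ra r' x) = ra (r * r') x;
  ra1 : forall x, ra 1 x = x;
  saDl : forall s s' x, sa (s + s') x = sa s x + sa s' x;
  saDr : forall s x x', sa s (x + x') = sa s x + sa s x';
  saM : forall s s' x, sa s (sa s' x) = sa (s * s') x;
  sa1 : forall x, sa 1 x = x;
  rsaC : forall r s x, ra r (sa s x) = sa s (ra r x);
  rsak : forall c x, ra c%:A x = sa c%:A x }.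

Definition biact (t : tensA) (x : X) : X := tens_lift (fun r s => ra r (sa s x)) t.

Hypothesis bX : bimodule.

Let bal x : balanced (fun r s => ra r (sa s x)).
Proof.
split=> [r r' s|r s s'|c r s]; rewrite ?(raDl bX) ?(saDl bX) ?(raDr bX) //.
by rewrite -mulr_algl mulrC -(raM bX) -(mulr_algl c s) -(saM bX) (rsak bX).
Qed.
Lemma biact_pure r s x : biact (pureA r s) x = ra r (sa s x).
Proof. exact: tens_lift_pure. Qed.
Lemma biactDl x : {morph biact^~ x : t u / t + u}.
Proof. by move=> t u; apply: tens_liftD. Qed.
Lemma biactDr : right_distributive biact +%R.
Proof.
move=> t x y; rewrite /biact /tens_lift -big_split; apply: eq_bigr => p _.
by rewrite saDr ?raDr.
Qed.
Let biact0 x : biact 0 x = 0.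
Proof. by apply: (addrI (biact 0 x)); rewrite -biactDl !addr0. Qed.
Let biactr0 t : biact t 0 = 0.
Proof. by apply: (addrI (biact t 0)); rewrite -biactDr !addr0. Qed.
Lemma biactA t u x : biact t (biact u x) = biact (t * u) x.
Proof.
elim/tens_ind: t => [|t t' IH IH'|r s]; first by rewrite mul0r !biact0.
  by rewrite mulrDl !biactDl IH IH'.
elim/tens_ind: u => [|u u' IH IH'|r' s']; first by rewrite mulr0 biact0 biactr0.
  by rewrite mulrDr !biactDl biactDr IH IH'.
by rewrite pureAM !biact_pure -rsaC // raM // saM.
Qed.
Lemma biact1 : left_id 1 biact.
Proof. by move=> x; rewrite biact_pure sa1 ?ra1. Qed.
End Bimodule.

(* M (x)_k N as a module over R (x)_k S. *)
Section TensorModule.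
Variables (M : lmodType R) (N : lmodType S).
Let Mk := restrict (GRing.in_alg R) M.
Let Nk := restrict (GRing.in_alg S) N.

Definition tensM : Type := tens Mk Nk.
HB.instance Definition _ := GRing.Zmodule.on tensM.

Definition pureM (m : M) (n : N) : tensM := @pure k Mk Nk m n.

Let ra (r : R) (x : tensM) : tensM := 
  tens_lift (fun (m : Mk) (n : Nk) => pureM (r *: (m : M)) n) x.
Let sa (s : S) (x : tensM) : tensM := 
  tens_lift (fun (m : Mk) (n : Nk) => pureM m (s *: (n : N))) x.

Let ra_bal r : balanced (fun (m : Mk) (n : Nk) => pureM (r *: (m : M)) n).
Proof.
split=> *; rewrite /pureM ?scalerDr ?pureDl ?pureDr //.
by rewrite -pureZ !rscaleE !scalerA mulrC.
Qed.
Let sa_bal s : balanced (fun (m : Mk) (n : Nk) => pureM m (s *: (n : N))).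
Proof.
split=> *; rewrite /pureM ?scalerDr ?pureDl ?pureDr //.
by rewrite pureZ !rscaleE !scalerA mulrC.
Qed.
Let raE r m n : ra r (pureM m n) = pureM (r *: m) n.
Proof. exact: (tens_lift_pure (ra_bal r)). Qed.
Let saE s m n : sa s (pureM m n) = pureM m (s *: n).
Proof. exact: (tens_lift_pure (sa_bal s)). Qed.
Let raDr r x x' : ra r (x + x') = ra r x + ra r x'.
Proof. exact: tens_liftD. Qed.
Let saDr s x x' : sa s (x + x') = sa s x + sa s x'.
Proof. exact: tens_liftD. Qed.
Let ra0 r : ra r 0 = 0.
Proof. exact: tens_lift0. Qed.
Let sa0 s : sa s 0 = 0.
Proof. exact: tens_lift0. Qed.

Fact tensM_bimodule : bimodule ra sa.
Proof.
split=> //.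
- move=> r r' x; elim/tens_ind: x => [|x x' IH IH'|m n]; first by rewrite !ra0 addr0.
    by rewrite !raDr IH IH' addrACA.
  by rewrite !raE /pureM scalerDl pureDl.
- move=> r r' x; elim/tens_ind: x => [|x x' IH IH'|m n]; first by rewrite !ra0.
    by rewrite !raDr IH IH'.
  by rewrite !raE scalerA.
- move=> x; elim/tens_ind: x => [|x x' IH IH'|m n]; first by rewrite !ra0.
    by rewrite !raDr IH IH'.
  by rewrite !raE scale1r.
- move=> r r' x; elim/tens_ind: x => [|x x' IH IH'|m n]; first by rewrite !sa0 addr0.
    by rewrite !saDr IH IH' addrACA.
  by rewrite !saE /pureM scalerDl pureDr.
- move=> r r' x; elim/tens_ind: x => [|x x' IH IH'|m n]; first by rewrite !sa0.
    by rewrite !saDr IH IH'.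
  by rewrite !saE scalerA.
- move=> x; elim/tens_ind: x => [|x x' IH IH'|m n]; first by rewrite !sa0.
    by rewrite !saDr IH IH'.
  by rewrite !saE scale1r.
- move=> r s x; elim/tens_ind: x => [|x x' IH IH'|m n]; first by rewrite sa0 ra0 sa0.
    by rewrite !(saDr, raDr) IH IH'.
  by rewrite !(saE, raE).
- move=> c x; elim/tens_ind: x => [|x x' IH IH'|m n]; first by rewrite sa0 ra0.
    by rewrite !(saDr, raDr) IH IH'.
  by rewrite !(saE, raE); exact: (@pureZ k Mk Nk).
Qed.
HB.instance Definition _ := GRing.Zmodule_isLmodule.Build tensA tensM
  (biactA tensM_bimodule) (biact1 tensM_bimodule)
  (biactDr tensM_bimodule) (biactDl tensM_bimodule).

Lemma tensM_scale r s m n : pureA r s *: pureM m n = pureM (r *: m) (s *: n).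
Proof. by rewrite -[LHS]/(biact _ _ _ _) (biact_pure tensM_bimodule) saE raE. Qed.
End TensorModule.
End TensorAlgebra.

(* M_t: fractions m / t^i, with m / t^i = m' / t^j iff t^(p+j) m = t^(p+i) m'
   for some p. *)
Section Localization.
Variables (A : comPzRingType) (t : A) (M : lmodType A).

Definition loc_eqb : rel (M * nat) := fun x y =>
  `[< exists p, t ^+ (p + y.2) *: x.1 = t ^+ (p + x.2) *: y.1 >].
Fact loc_equiv : equiv_class_of loc_eqb.
Proof.
split=> [x|x y|y x z]; first by apply/asboolP; exists 0%N.
  by apply/asboolP/asboolP => -[p E]; exists p.
move=> /asboolP[p E] /asboolP[q E']; apply/asboolP; exists (p + q + y.2)%N.
have -> : (p + q + y.2 + z.2 = (q + z.2) + (p + y.2))%N by lia.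
rewrite exprD -scalerA E scalerA -exprD.
have -> : (q + z.2 + (p + x.2) = (p + x.2) + (q + z.2))%N by rewrite addnC.
by rewrite exprD -scalerA E' scalerA -exprD; congr (t ^+ _ *: _); lia.
Qed.
Canonical loc_equiv_rel := EquivRelPack loc_equiv.
Canonical loc_encModRel := defaultEncModRel loc_eqb.

Definition loc : Type := {eq_quot loc_eqb}.
HB.instance Definition _ := Choice.on loc.

Definition frac (m : M) (i : nat) : loc := \pi_{eq_quot loc_eqb} (m, i).

Lemma fracP m i m' j :
  frac m i = frac m' j <-> exists p, t ^+ (p + j) *: m = t ^+ (p + i) *: m'.
Proof. by split=> [/eqmodP/asboolP|h]; last exact/eqmodP/asboolP. Qed.

Definition loc_repr (x : loc) : M * nat := repr (x : {eq_quot loc_eqb}).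
Lemma loc_reprK x : frac (loc_repr x).1 (loc_repr x).2 = x.
Proof. by rewrite /frac -surjective_pairing; exact: reprK. Qed.
Lemma loc_ind (P : loc -> Prop) : (forall m i, P (frac m i)) -> forall x, P x.
Proof. by move=> h x; rewrite -(loc_reprK x). Qed.

Lemma frac_shift p m i : frac (t ^+ p *: m) (p + i) = frac m i.
Proof. by apply/fracP; exists 0%N; rewrite scalerA -exprD !add0n addnC. Qed.

Let ladd (x y : loc) : loc :=
  let: (m, i) := loc_repr x in let: (m', j) := loc_repr y in
  frac (t ^+ j *: m + t ^+ i *: m') (i + j).
Let lopp (x : loc) : loc := frac (- (loc_repr x).1) (loc_repr x).2.

Let frac_repr m i : exists p,
  t ^+ (p + i) *: (loc_repr (frac m i)).1 = t ^+ (p + (loc_repr (frac m i)).2) *: m.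
Proof. by apply/fracP; rewrite loc_reprK. Qed.

Let laddE m i m' j :
  ladd (frac m i) (frac m' j) = frac (t ^+ j *: m + t ^+ i *: m') (i + j).
Proof.
rewrite /ladd; have := frac_repr m i; have := frac_repr m' j.
case: (loc_repr _) => m1' j1 /= [q E']; case: (loc_repr _) => m1 i1 /= [p E].
apply/fracP; exists (p + q)%N; rewrite !scalerDr !scalerA -!exprD.
congr (_ + _).
  have -> : (p + q + (i + j) + j1 = (q + j + j1) + (p + i))%N by lia.
  by rewrite exprD -scalerA E scalerA -exprD; congr (t ^+ _ *: _); lia.
have -> : (p + q + (i + j) + i1 = (p + i + i1) + (q + j))%N by lia.
by rewrite exprD -scalerA E' scalerA -exprD; congr (t ^+ _ *: _); lia.
Qed.
Let loppE m i : lopp (frac m i) = frac (- m) i.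
Proof.
rewrite /lopp; have [p E] := frac_repr m i.
by apply/fracP; exists p; rewrite !scalerN E.
Qed.
Fact laddA : associative ladd.
Proof.
elim/loc_ind => m1 i1; elim/loc_ind => m2 i2; elim/loc_ind => m3 i3.
rewrite !laddE addnA !scalerDr !scalerA -!exprD addrA.
by rewrite [(i3 + i2)%N]addnC [(i3 + i1)%N]addnC.
Qed.
Fact laddC : commutative ladd.
Proof.
by elim/loc_ind => m1 i1; elim/loc_ind => m2 i2; rewrite !laddE addrC addnC.
Qed.
Fact ladd0 : left_id (frac 0 0) ladd.
Proof.
by elim/loc_ind => m i; rewrite laddE scaler0 add0r expr0 scale1r.
Qed.
Fact laddN : left_inverse (frac 0 0) lopp ladd.
Proof.
elim/loc_ind => m i; rewrite loppE laddE scalerN addNr.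
by apply/fracP; exists 0%N; rewrite !scaler0.
Qed.
HB.instance Definition _ := GRing.isZmodule.Build loc laddA laddC ladd0 laddN.

Lemma fracD m i m' j :
  frac m i + frac m' j = frac (t ^+ j *: m + t ^+ i *: m') (i + j).
Proof. exact: laddE. Qed.
Lemma fracDn m m' i : frac m i + frac m' i = frac (m + m') i.
Proof. by rewrite fracD -scalerDr frac_shift. Qed.
End Localization.

(* The action (a / t^i) (m / t^j) = (a m) / t^(i + j) of A_t on M_t. *)
Section LocalizedAction.
Variables (A : comPzRingType) (t : A) (M : lmodType A).

Definition locact (x : loc t A^o) (y : loc t M) : loc t M :=
  let: (a, i) := loc_repr x in let: (m, j) := loc_repr y in
  frac t ((a : A) *: m) (i + j).

Lemma locactE (a : A) i m j :
  locact (frac t (a : A^o) i) (frac t m j) = frac t (a *: m) (i + j).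
Proof.
rewrite /locact; have := loc_reprK (frac t (a : A^o) i).
have := loc_reprK (frac t m j).
case: (loc_repr _) => m' j' /= /fracP[q E']; case: (loc_repr _) => a' i' /= /fracP[p E].
apply/fracP; exists (p + q)%N; rewrite !scalerA.
have {}E : t ^+ (p + i) * a' = t ^+ (p + i') * a by exact: E.
have -> : (p + q + (i + j) = (p + i) + (q + j))%N by lia.
rewrite exprD mulrAC E -[LHS]scalerA E' !scalerA mulrAC -exprD.
by congr (t ^+ _ * _ *: _); lia.
Qed.
Lemma locactDl x y z : locact (x + y) z = locact x z + locact y z.
Proof.
elim/loc_ind: x => a i; elim/loc_ind: y => b j; elim/loc_ind: z => m l.
rewrite fracD !locactE fracD; apply/fracP; exists 0%N.
rewrite scalerDl !scalerDr !scalerA !mulrA -!exprD.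
by congr (t ^+ _ * _ *: _ + t ^+ _ * _ *: _); lia.
Qed.
Lemma locactDr x y z : locact x (y + z) = locact x y + locact x z.
Proof.
elim/loc_ind: x => a i; elim/loc_ind: y => m j; elim/loc_ind: z => m' l.
rewrite fracD !locactE fracD; apply/fracP; exists 0%N.
have C (b : A) (v : M) : (a : A) *: (b *: v) = b *: ((a : A) *: v).
  by rewrite !scalerA mulrC.
rewrite !scalerDr !C !(scalerA (t ^+ _)) -!exprD.
by congr (t ^+ _ *: _ + t ^+ _ *: _); lia.
Qed.
Lemma locact1 x : locact (frac t (1 : A^o) 0) x = x.
Proof. by elim/loc_ind: x => m i; rewrite locactE scale1r. Qed.
End LocalizedAction.

Lemma locactA (A : comPzRingType) (t : A) (M : lmodType A) x y (z : loc t M) :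
  locact x (locact y z) = locact (locact x y) z.
Proof.
elim/loc_ind: x => a i; elim/loc_ind: y => b j; elim/loc_ind: z => m l.
by rewrite !locactE scalerA addnA.
Qed.

Section DVR.
Variable A : comNzRingType.

Definition is_ideal (I : A -> Prop) : Prop :=
  [/\ I 0, forall x y, I x -> I y -> I (x + y) & forall a x, I x -> I (a * x)].
Definition maximal_ideal (I : A -> Prop) : Prop :=
  [/\ is_ideal I, ~ I 1 &
      forall J, is_ideal J -> (forall x, I x -> J x) -> ~ J 1 ->
        forall x, J x -> I x].
Definition principal (t : A) : A -> Prop := fun x => exists a, x = a * t.

(* A is a local principal ideal domain, not a field, with maximal ideal tA. *)
Definition is_dvr (t : A) : Prop :=
  [/\ GRing.integral_domain_axiom A,
      forall I, is_ideal I -> exists a, forall x, I x <-> principal a x,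
      maximal_ideal (principal t),
      forall I, maximal_ideal I -> forall x, I x <-> principal t x
    & t != 0].
End DVR.

(* A DVR that is a k-algebra, with chosen generator of the maximal ideal and
   with residue field k. *)
Record dvr (k : fieldType) := Dvr {
  dvr_alg :> comAlgType k;
  dvr_unif : dvr_alg;
  dvrP : is_dvr dvr_unif;
  dvr_residue : bijective
    (fun c : k => mod_pi dvr_unif (M := dvr_alg^o) (c%:A : dvr_alg)) }.

(* V_t; nonzero since t is not nilpotent, hence a comAlgType. *)
Section DVRLocalization.
Variables (k : fieldType) (V : dvr k).
Local Notation t := (dvr_unif V).

Lemma dvr_unifX_neq0 p : t ^+ p != 0.
Proof.
have [dom _ _ _ t0] := dvrP V.
elim: p => [|p IHp]; first by rewrite expr0 oner_eq0.
by rewrite exprS; apply/eqP => /dom; rewrite (negPf t0) (negPf IHp).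
Qed.

Definition dvr_loc : Type := loc t V^o.
HB.instance Definition _ := GRing.Zmodule.on dvr_loc.

Definition dvr_frac (v : V) (i : nat) : dvr_loc := frac t (v : V^o) i.
Let vmul (x y : dvr_loc) : dvr_loc := locact x y.

Let vmulE v i w j : vmul (dvr_frac v i) (dvr_frac w j) = dvr_frac (v * w) (i + j).
Proof. exact: locactE. Qed.
Fact vmulA : associative vmul.
Proof. exact: locactA. Qed.
Fact vmulC : commutative vmul.
Proof.
elim/loc_ind => v i; elim/loc_ind => w j.
by rewrite ![vmul _ _]vmulE mulrC addnC.
Qed.
Fact vmul1 : left_id (dvr_frac 1 0) vmul.
Proof. exact: locact1. Qed.
Fact vmulDl : left_distributive vmul +%R.
Proof. by move=> x y z; apply: locactDl. Qed.
Fact dvr_frac1_neq0 : dvr_frac 1 0 != 0.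
Proof.
apply/eqP => /fracP[p]; rewrite scaler0 => E.
have := dvr_unifX_neq0 (p + 0); rewrite -[t ^+ _]mulr1.
by rewrite [_ * 1](E : _ = 0) eqxx.
Qed.
HB.instance Definition _ :=
  GRing.Zmodule_isComNzRing.Build dvr_loc vmulA vmulC vmul1 vmulDl dvr_frac1_neq0.

Lemma dvr_fracM v i w j : dvr_frac v i * dvr_frac w j = dvr_frac (v * w) (i + j).
Proof. exact: vmulE. Qed.

Let vscale (c : k) (x : dvr_loc) : dvr_loc := dvr_frac c%:A 0 * x.
Fact vscaleA a b x : vscale a (vscale b x) = vscale (a * b) x.
Proof. by rewrite /vscale mulrA dvr_fracM -scalerAl mul1r scalerA. Qed.
Fact vscale1 : left_id 1 vscale.
Proof. by move=> x; rewrite /vscale scale1r mul1r. Qed.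
Fact vscaleDr : right_distributive vscale +%R.
Proof. by move=> a x y; rewrite /vscale mulrDr. Qed.
Fact vscaleDl x : {morph vscale^~ x : a b / a + b}.
Proof.
by move=> a b; rewrite /vscale -mulrDl scalerDl; congr (_ * _); rewrite [RHS]fracDn.
Qed.
HB.instance Definition _ :=
  GRing.Zmodule_isLmodule.Build k dvr_loc vscaleA vscale1 vscaleDr vscaleDl.
Fact vscaleAl (a : k) (x y : dvr_loc) : a *: (x * y) = (a *: x) * y.
Proof. exact: mulrA. Qed.
HB.instance Definition _ := GRing.Lmodule_isLalgebra.Build k dvr_loc vscaleAl.
HB.instance Definition _ := GRing.Lalgebra_isComAlgebra.Build k dvr_loc.

Lemma dvr_frac_alg c : c%:A = dvr_frac c%:A 0 :> dvr_loc.
Proof. exact: mulr1. Qed.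
End DVRLocalization.

(* Q_t as a module over R (x)_k V_t:
   (r (x) v / t^i) (q / t^j) = (r (x) v) q / t^(i + j). *)
Section ModuleLocalization.
Variables (k : fieldType) (R : comAlgType k) (V : dvr k).
Variable Q : lmodType (tensA R V).
Local Notation t := (dvr_unif V).
Let QV := restrict (@inr_alg k R V) Q.

Definition mod_loc : Type := loc t QV.
HB.instance Definition _ := GRing.Zmodule.on mod_loc.

Definition mod_frac (q : Q) (i : nat) : mod_loc := frac t (q : QV) i.
Lemma mod_loc_ind (P : mod_loc -> Prop) : (forall q i, P (mod_frac q i)) -> forall x, P x.
Proof. exact: (@loc_ind V t QV). Qed.
Let ra (r : R) (x : mod_loc) : mod_loc :=
  mod_frac (inl_alg V r *: ((loc_repr x).1 : Q)) (loc_repr x).2.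
Let sa (v : dvr_loc V) (x : mod_loc) : mod_loc := locact v x.

Let inlrC (r : R) (v : V) (q : Q) :
  inl_alg V r *: (v *: (q : QV) : Q) = v *: (inl_alg V r *: q : QV).
Proof. by rewrite !rscaleE !scalerA mulrC. Qed.
Let raE r q i : ra r (mod_frac q i) = mod_frac (inl_alg V r *: q) i.
Proof.
rewrite /ra; have := loc_reprK (mod_frac q i).
case: (loc_repr _) => q' i' /= /fracP[p E]; apply/fracP; exists p.
by rewrite -!inlrC E.
Qed.
Let saE v i q j : sa (dvr_frac v i) (mod_frac q j) =
  mod_frac (inr_alg R v *: q) (i + j).
Proof. exact: locactE. Qed.

Fact mod_loc_bimodule : bimodule ra sa.
Proof.
split.
- move=> r r'; elim/mod_loc_ind => q i; rewrite !raE [RHS]fracDn.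
  by rewrite /mod_frac rmorphD scalerDl.
- move=> r; elim/mod_loc_ind => q i; elim/mod_loc_ind => q' j.
  rewrite fracD !raE [RHS]fracD -!inlrC.
  exact: (congr1 (mod_frac^~ _) (scalerDr _ _ _)).
- move=> r r'; elim/mod_loc_ind => q i.
  by rewrite !raE scalerA rmorphM.
- by elim/mod_loc_ind => q i; rewrite raE rmorph1 scale1r.
- by move=> *; apply: locactDl.
- by move=> *; apply: locactDr.
- by move=> *; apply: locactA.
- by move=> *; apply: locact1.
- move=> r; elim/loc_ind => v i; elim/mod_loc_ind => q j.
  by rewrite [sa _ _]saE !raE [RHS]saE !scalerA mulrC.
- move=> c; elim/mod_loc_ind => q i.
  rewrite dvr_frac_alg [RHS]saE raE; congr (mod_frac (_ *: _) _).
  exact: (@pureZ k R V).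
Qed.
HB.instance Definition _ := GRing.Zmodule_isLmodule.Build (tensA R (dvr_loc V)) mod_loc
  (biactA mod_loc_bimodule) (biact1 mod_loc_bimodule)
  (biactDr mod_loc_bimodule) (biactDl mod_loc_bimodule).

Lemma mod_loc_scale r v i q j :
  pureA r (dvr_frac v i) *: mod_frac q j = mod_frac (pureA r v *: q) (i + j).
Proof.
rewrite -[LHS]/(biact _ _ _ _) (biact_pure mod_loc_bimodule) saE raE scalerA.
by rewrite pureAM mulr1 mul1r.
Qed.
End ModuleLocalization.

Definition degenerates (k : fieldType) (R : comAlgType k) (M N : lmodType R) : Prop :=
  exists (V : dvr k) (Q : lmodType (tensA R V)),
    [/\ fin_gen Q,
        flat (restrict (@inr_alg k R V) Q),
        lmod_iso (restrict (@inl_alg k R V) (mod_elt (inr_alg R (dvr_unif V)) Q)) N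
      & lmod_iso (mod_loc Q) (tensM M (dvr_loc V)^o)].

(* k[[x_0, ..., x_(n-1)]] *)
Section PowerSeries.
Variables (n : nat) (k : comNzRingType).

Record powser := PowSer { pcoef : 'X_{1..n} -> k }.
HB.instance Definition _ := gen_eqMixin powser.
HB.instance Definition _ := gen_choiceMixin powser.

Lemma powserP f g : pcoef f =1 pcoef g -> f = g.
Proof. by case: f g => [f] [g] /= /funext->. Qed.

Let pzero := PowSer (fun=> 0).
Let padd f g := PowSer (fun m => pcoef f m + pcoef g m).
Let popp f := PowSer (fun m => - pcoef f m).
Fact paddA : associative padd.
Proof. by move=> f g h; apply: powserP => m /=; rewrite addrA. Qed.
Fact paddC : commutative padd.
Proof. by move=> f g; apply: powserP => m /=; rewrite addrC. Qed.
Fact padd0 : left_id pzero padd.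
Proof. by move=> f; apply: powserP => m /=; rewrite add0r. Qed.
Fact paddN : left_inverse pzero popp padd.
Proof. by move=> f; apply: powserP => m /=; rewrite addNr. Qed.
HB.instance Definition _ := GRing.isZmodule.Build powser paddA paddC padd0 paddN.

Definition pone := PowSer (fun m => (m == 0%MM)%:R).
Definition pmul f g := PowSer (fun m =>
  \sum_(d : 'X_{1..n < (mdeg m).+1, (mdeg m).+1} | m == (d.1 + d.2)%MM)
    pcoef f d.1 * pcoef g d.2).

Let trunc b f : {mpoly k[n]} := \sum_(m : 'X_{1..n < b}) pcoef f m *: 'X_[m].
Let truncE b f m : (mdeg m < b)%N -> (trunc b f)@_m = pcoef f m.
Proof.
move=> lt_mb; rewrite /trunc raddf_sum /= (bigD1 (BMultinom lt_mb)) //=.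
rewrite mcoeffZ mcoeffX eqxx mulr1 big1 ?addr0 // => m' ne.
rewrite mcoeffZ mcoeffX; case: eqP => [E|_]; last by rewrite mulr0.
by case/eqP: ne; apply/val_inj.
Qed.
Let trunc_mul (p q : {mpoly k[n]}) f g m :
    (forall m', (mdeg m' <= mdeg m)%N -> p@_m' = pcoef f m') ->
    (forall m', (mdeg m' <= mdeg m)%N -> q@_m' = pcoef g m') ->
  (p * q)@_m = pcoef (pmul f g) m.
Proof.
move=> Ep Eq; rewrite mcoeffM; apply: eq_bigr => -[[d1 /= h1] [d2 /= h2]] _.
by rewrite Ep ?Eq.
Qed.

Fact pmulA : associative pmul.
Proof.
move=> f g h; apply: powserP => m; pose b := (mdeg m).+1.
have E f' m' : (mdeg m' <= mdeg m)%N -> (trunc b f')@_m' = pcoef f' m'.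
  by move=> le_m; apply: truncE.
have EM f' g' m' : (mdeg m' <= mdeg m)%N ->
    (trunc b f' * trunc b g')@_m' = pcoef (pmul f' g') m'.
  by move=> le_m; apply: trunc_mul => m1 le_m1; apply/E/(leq_trans le_m1).
by rewrite -(trunc_mul (E f) (EM g h)) -(trunc_mul (EM f g) (E h)) mulrA.
Qed.
Fact pmulC : commutative pmul.
Proof.
move=> f g; apply: powserP => m; pose b := (mdeg m).+1.
have E f' m' : (mdeg m' <= mdeg m)%N -> (trunc b f')@_m' = pcoef f' m'.
  by move=> le_m; apply: truncE.
by rewrite -(trunc_mul (E f) (E g)) -(trunc_mul (E g) (E f)) mulrC.
Qed.
Fact pmul1 : left_id pone pmul.
Proof.
move=> f; apply: powserP => m; rewrite -(@trunc_mul 1 (trunc (mdeg m).+1 f)).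
- by rewrite mul1r truncE.
- by move=> m' _; rewrite mcoeff1.
- by move=> m' le_m'; rewrite truncE.
Qed.
Fact pmulDl : left_distributive pmul +%R.
Proof.
move=> f g h; apply: powserP => m /=; rewrite -big_split.
by apply: eq_bigr => d _; rewrite mulrDl.
Qed.
Fact pone_neq0 : pone != 0.
Proof. by apply/eqP => -[/(congr1 (@^~ 0%MM))]/eqP; rewrite eqxx oner_eq0. Qed.
HB.instance Definition _ :=
  GRing.Zmodule_isComNzRing.Build powser pmulA pmulC pmul1 pmulDl pone_neq0.

Let pscale c f := PowSer (fun m => c * pcoef f m).
Fact pscaleA a b f : pscale a (pscale b f) = pscale (a * b) f.
Proof. by apply: powserP => m /=; rewrite mulrA. Qed.
Fact pscale1 : left_id 1 pscale.
Proof. by move=> f; apply: powserP => m /=; rewrite mul1r. Qed.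
Fact pscaleDr : right_distributive pscale +%R.
Proof. by move=> a f g; apply: powserP => m /=; rewrite mulrDr. Qed.
Fact pscaleDl f : {morph pscale^~ f : a b / a + b}.
Proof. by move=> a b; apply: powserP => m /=; rewrite mulrDl. Qed.
HB.instance Definition _ :=
  GRing.Zmodule_isLmodule.Build k powser pscaleA pscale1 pscaleDr pscaleDl.
Fact pscaleAl (a : k) (f g : powser) : a *: (f * g) = (a *: f) * g.
Proof.
apply: powserP => m /=; rewrite mulr_sumr.
by apply: eq_bigr => d _; rewrite mulrA.
Qed.
HB.instance Definition _ := GRing.Lmodule_isLalgebra.Build k powser pscaleAl.
HB.instance Definition _ := GRing.Lalgebra_isComAlgebra.Build k powser.

Definition pvar (i : 'I_n) : powser := PowSer (fun m => (m == U_(i)%MM)%:R).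

Lemma pcoef0D f g : pcoef (f + g) 0%MM = pcoef f 0%MM + pcoef g 0%MM.
Proof. by []. Qed.
Lemma pcoef0M f g : pcoef (f * g) 0%MM = pcoef f 0%MM * pcoef g 0%MM.
Proof.
rewrite -(@trunc_mul (trunc 1 f) (trunc 1 g)).
- by rewrite rmorphM /= !truncE ?mdeg0.
- by move=> m; rewrite mdeg0 leqn0 => /eqP dm0; rewrite truncE ?dm0.
- by move=> m; rewrite mdeg0 leqn0 => /eqP dm0; rewrite truncE ?dm0.
Qed.
Lemma pcoef0_pvar i : pcoef (pvar i) 0%MM = 0.
Proof. by rewrite /= eq_sym mnm1_eq0. Qed.

Lemma proper_powser_ideal (f : powser) : pcoef f 0%MM = 0 -> 1 \notin ideal_pred [:: f].
Proof.
move=> f0; apply/negP => /asboolP[c /(congr1 (pcoef^~ 0%MM))].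
rewrite big_ord1 [c _ *: _]/(c _ * f) pcoef0M f0 mulr0 /= eqxx.
by move/eqP; rewrite oner_eq0.
Qed.
End PowerSeries.

Section Rings.
Variable k : comNzRingType.

(* k[[x, y]] / (x^2) *)
Section DoubleLine.
Local Notation X := (pvar k (0 : 'I_2)).
Local Notation Y := (pvar k (1 : 'I_2)).

Fact double_line_proper : 1 \notin ideal_pred [:: X ^+ 2].
Proof. by apply: proper_powser_ideal; rewrite pcoef0M pcoef0_pvar mul0r. Qed.
Definition double_line : comAlgType k := quo_alg double_line_proper.
Definition double_line_x : double_line := quo_pi double_line_proper X.
Definition double_line_y : double_line := quo_pi double_line_proper Y.
End DoubleLine.

(* k[[x, y, z]] / (xy) *)
Section CrossingPlanes.
Local Notation X := (pvar k (0 : 'I_3)).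
Local Notation Y := (pvar k (1 : 'I_3)).
Local Notation Z := (pvar k (2%:R : 'I_3)).

Fact crossing_planes_proper : 1 \notin ideal_pred [:: X * Y].
Proof. by apply: proper_powser_ideal; rewrite pcoef0M pcoef0_pvar mul0r. Qed.
Definition crossing_planes : comAlgType k := quo_alg crossing_planes_proper.
Definition crossing_planes_x : crossing_planes := quo_pi crossing_planes_proper X.
Definition crossing_planes_y : crossing_planes := quo_pi crossing_planes_proper Y.
Definition crossing_planes_z : crossing_planes := quo_pi crossing_planes_proper Z.
End CrossingPlanes.
End Rings.

(* Main.v *)
From HB Require Import structures.
From mathcomp Require Import all_boot all_algebra.
From mathcomp Require Import generic_quotient boolp.
From mathcomp.multinomials Require Import mpoly.
From mathcomp Require Import zify ring.
Require Import Defs.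

(** A degeneration of M to N is a lattice Q in W = M (x) V_t: it has no t-torsion, Q / tQ is N,
    and it spans W over V_t.

    Relations pass from M to Q up to a power of t. If w (ker r) is contained in s (ker r') in M,
    then t ^+ l * w (ker r) is contained in s (ker r') in Q ([degenerates_specialization]):
    an element of W killed by r is a sum of tensors m (x) v with r m = 0
    ([integral_slices]), and denominators are bounded since M and Q are finitely generated.

    For the crossing planes, the ideals (x, z^a) satisfy ker x = im y. This equality extends to Q,
    because the quotient of ker x by im y on Q is both t-divisible and killed by a power of t.
    Then ker y / im x has no t-torsion on Q, every element of ker y on N lifts to ker y on Q, and
    so whatever annihilates ker y / im x on M also annihilates it on N ([degenerates_kernel]).
    On (x, z^a) this quotient is k[[z]] / (z^a), and z^a does not annihilate k[[z]] / (z^b) when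
    a < b ([crossing_not_degenerates]).

    For the double line, put K = ker x on Q. On N = (x, y^b) the kernel of x is free of rank one
    over k[[y]], with generator g, and K / tK is the submodule generated by y^e g for some e. One has
    xQ <= y^a K, and D = y^a K / xQ is killed by a power of t. The cokernel of t on D has
    length b - a - e, and its kernel is the torsion of N / K, of length e. A nilpotent
    endomorphism of a module of finite length has kernel and cokernel of the same length, so
    b = a + 2e ([parity_formula]).

    Conversely, over k[[y]] the module (x, y^a) is free of rank two, and x acts as y^a E_12.
    The matrix with rows y^a (t y^c, y^2c) and y^a (- t^2, - t y^c) has square zero, is conjugate
    to y^a E_12 once t is invertible, and is y^(a + 2c) E_12 at t = 0. With V = k[[t]] the
    corresponding lattice is spanned in (x, y^a) (x) V_t by y^a (x) t^2 and
    y^(a + c) (x) t - x (x) 1 ([double_line_degenerates]). *)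

Set Implicit Arguments.
Unset Strict Implicit.
Unset Printing Implicit Defensive.

Import GRing.Theory.
Local Open Scope ring_scope.

(** * Tensors, submodules and quotients *)

Section PureTensors.
Variables (A : comPzRingType) (M N : lmodType A).

Lemma pure0l (n : N) : pure (0 : M) n = 0.
Proof. by apply: (addrI (pure 0 n)); rewrite -pureDl !addr0. Qed.
Lemma pure0r (m : M) : pure m (0 : N) = 0.
Proof. by apply: (addrI (pure m 0)); rewrite -pureDr !addr0. Qed.
Lemma pure_suml I (s : seq I) (P : pred I) (F : I -> M) (n : N) :
  pure (\sum_(i <- s | P i) F i) n = \sum_(i <- s | P i) pure (F i) n.
Proof. exact: (big_morph (fun m => pure m n) (fun m m' => pureDl m m' n) (pure0l n)). Qed.
Lemma pure_sumr I (s : seq I) (P : pred I) (m : M) (F : I -> N) :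
  pure m (\sum_(i <- s | P i) F i) = \sum_(i <- s | P i) pure m (F i).
Proof. exact: (big_morph (pure m) (pureDr m) (pure0r m)). Qed.
End PureTensors.

Section SpanModule.
Variables (A : pzRingType) (M : lmodType A) (s : seq M).

(** The submodule spanned by s, as a module in its own right. *)
Record span_mod := SpanMod { span_val : M; _ : span s span_val }.
HB.instance Definition _ := [isSub for span_val].
HB.instance Definition _ := [Choice of span_mod by <:].
HB.instance Definition _ :=
  GRing.SubChoice_isSubLmodule.Build A M (span s) span_mod (span_submod s).

Lemma span_val_inj : injective span_val.
Proof. by move=> [u hu] [v hv] /= E; subst v; congr SpanMod; exact: bool_irrelevance. Qed.
End SpanModule.

Section SpanPair.
Variables (A : pzRingType) (M : lmodType A) (u v : M).
Local Notation Q := (span_mod [:: u; v]).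

Lemma span2P w : span [:: u; v] w <-> exists c d, w = c *: u + d *: v.
Proof.
split=> [/asboolP[c ->]|[c [d ->]]].
  by exists (c ord0), (c (lift ord0 ord0)); rewrite !big_ord_recl big_ord0 addr0.
apply/asboolP; exists (fun i => if i == ord0 then c else d).
by rewrite !big_ord_recl big_ord0 addr0.
Qed.
Fact span2_fst_mem : span [:: u; v] u.
Proof. by apply/span2P; exists 1, 0; rewrite scale1r scale0r addr0. Qed.
Fact span2_snd_mem : span [:: u; v] v.
Proof. by apply/span2P; exists 0, 1; rewrite scale1r scale0r add0r. Qed.
Definition span2_fst : Q := SpanMod span2_fst_mem.
Definition span2_snd : Q := SpanMod span2_snd_mem.
Lemma span2_gen (q : Q) : exists c d, q = c *: span2_fst + d *: span2_snd.
Proof.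
case: q => w h; have /span2P[c [d E]] := h; exists c, d.
exact: span_val_inj.
Qed.
End SpanPair.

Lemma pair_fin_gen (A : pzRingType) (M : lmodType A) (u v : M) :
  (forall m, exists c d, m = c *: u + d *: v) -> fin_gen M.
Proof. by move=> gen; exists [:: u; v] => m; apply/span2P. Qed.

(** w (ker r) is contained in s (ker r'). With r = 0, or with r' = 0, this compares an image
    with a kernel: all the relations between x and y that are needed have this form. *)
Definition kernel_sub (A : pzRingType) (X : lmodType A) (w s r r' : A) : Prop :=
  forall x : X, r *: x = 0 -> exists2 x', w *: x = s *: x' & r' *: x' = 0.

Lemma ideal_val_inj (R : comNzRingType) (s : seq R) : injective (@ideal_val R s).
Proof. by move=> [u hu] [v hv] /= E; subst v; congr Ideal; exact: bool_irrelevance. Qed.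

Section TwoGeneratedIdeal.
Variables (R : comNzRingType) (u v : R).
Local Notation I := (ideal [:: u; v]).

Lemma ideal2P (r : R) : ideal_pred [:: u; v] r <-> exists c d, r = c * u + d * v.
Proof. exact: (@span2P R R^o). Qed.
Lemma ideal2_val (m : I) : exists c d, (ideal_val m : R) = c * u + d * v.
Proof. by case: m => m /= /ideal2P. Qed.
Fact ideal2_fst_mem : ideal_pred [:: u; v] u.
Proof. by apply/ideal2P; exists 1, 0; rewrite mul1r mul0r addr0. Qed.
Fact ideal2_snd_mem : ideal_pred [:: u; v] v.
Proof. by apply/ideal2P; exists 0, 1; rewrite mul1r mul0r add0r. Qed.
Definition ideal2_fst : I := Ideal ideal2_fst_mem.
Definition ideal2_snd : I := Ideal ideal2_snd_mem.

Lemma ideal2_gen (m : I) : exists c d, m = c *: ideal2_fst + d *: ideal2_snd.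
Proof. by have [c [d E]] := ideal2_val m; exists c, d; apply: ideal_val_inj. Qed.

Lemma ideal2_fin_gen : fin_gen I.
Proof. exact: pair_fin_gen ideal2_gen. Qed.

Lemma kernel_sub_ideal w s r r' : kernel_sub I w s r r' <->
  forall m, (exists c d, m = c * u + d * v) -> r * m = 0 ->
    exists m', [/\ exists c d, m' = c * u + d * v, w * m = s * m' & r' * m' = 0].
Proof.
split=> [sol m /ideal2P Im rm|sol m rm].
  have [|m' Em rm'] := sol (Ideal Im); first exact: ideal_val_inj.
  exists (ideal_val m' : R); split; first exact: ideal2_val.
    exact: (congr1 (@ideal_val _ _) Em).
  exact: (congr1 (@ideal_val _ _) rm').
have [|m' [/ideal2P Im' Em rm']] := sol (ideal_val m : R) (ideal2_val m).
  exact: (congr1 (@ideal_val _ _) rm).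
by exists (Ideal Im'); apply: ideal_val_inj.
Qed.
End TwoGeneratedIdeal.

Section QuotientMap.
Variables (k : comNzRingType) (P : comAlgType k) (s : seq P).
Hypothesis s_proper : 1 \notin ideal_pred s.
Local Notation pi := (quo_pi s_proper).

Fact quo_pi_zmod : zmod_morphism pi.
Proof. by move=> p q; apply: (addIr (pi q)); rewrite -quo_piD !subrK. Qed.
Fact quo_pi_monoid : monoid_morphism pi.
Proof. by split; [exact: quo_pi1 | exact: quo_piM]. Qed.
HB.instance Definition _ := GRing.isZmodMorphism.Build _ _ pi quo_pi_zmod.
HB.instance Definition _ := GRing.isMonoidMorphism.Build _ _ pi quo_pi_monoid.

Lemma quo_pi_surj (r : quo_alg s_proper) : exists p, r = pi p.
Proof. by exists (repr (r : quo_alg s_proper)); rewrite /quo_pi reprK. Qed.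
Lemma quo_pi_eq0 p : pi p = 0 <-> ideal_pred s p.
Proof.
rewrite -(rmorph0 pi); split=> [/eqP|h]; first by rewrite -Quotient.idealrBE subr0.
by apply/eqP; rewrite -Quotient.idealrBE subr0.
Qed.
End QuotientMap.

Lemma quo1_pi_eq0 (k : comNzRingType) (P : comAlgType k) (f : P)
    (f_proper : 1 \notin ideal_pred [:: f]) p :
  quo_pi f_proper p = 0 <-> exists c, p = c * f.
Proof.
split=> [/quo_pi_eq0/asboolP[c ->]|[c ->]].
  by exists (c ord0); rewrite big_ord1.
by apply/quo_pi_eq0/asboolP; exists (fun=> c); rewrite big_ord1.
Qed.

(** * Power series *)

Section PowerSeries.
Variables (n : nat) (k : comNzRingType).
Implicit Types (f g : powser n k) (m : 'X_{1..n}) (i : 'I_n).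

Lemma pcoefD f g m : pcoef (f + g) m = pcoef f m + pcoef g m.
Proof. by []. Qed.
Lemma pcoefN f m : pcoef (- f) m = - pcoef f m.
Proof. by []. Qed.
Lemma pcoefZ (c : k) f m : pcoef (c *: f) m = c * pcoef f m.
Proof. by []. Qed.
Lemma pcoef1 m : pcoef (1 : powser n k) m = (m == 0%MM)%:R.
Proof. by []. Qed.
Lemma pcoef_sum I (r : seq I) (P : pred I) (F : I -> powser n k) m :
  pcoef (\sum_(i <- r | P i) F i) m = \sum_(i <- r | P i) pcoef (F i) m.
Proof. exact: (big_morph (fun f => pcoef f m)). Qed.

Lemma pcoefM f g m : pcoef (f * g) m =
  \sum_(d : 'X_{1..n < (mdeg m).+1, (mdeg m).+1} | m == (d.1 + d.2)%MM)
    pcoef f d.1 * pcoef g d.2.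
Proof. by []. Qed.

Lemma pcoefM_eq f f' g g' m :
    (forall m', (mdeg m' <= mdeg m)%N -> pcoef f m' = pcoef f' m') ->
    (forall m', (mdeg m' <= mdeg m)%N -> pcoef g m' = pcoef g' m') ->
  pcoef (f * g) m = pcoef (f' * g') m.
Proof.
move=> Ef Eg; rewrite !pcoefM; apply: eq_bigr => -[[d1 /= h1] [d2 /= h2]] _.
by rewrite Ef ?Eg.
Qed.

Lemma pcoef_pvarM i f m :
  pcoef (pvar k i * f) m = if (0 < m i)%N then pcoef f (m - U_(i))%MM else 0.
Proof.
rewrite pcoefM; case: ifP => [mi|/negbT]; last first.
  rewrite -eqn0Ngt => /eqP mi; apply: big1 => -[[d1 h1] [d2 h2]] /= /eqP E.
  case: eqP => [Ed|_]; last by rewrite mul0r.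
  by move: mi; rewrite E Ed mnmDE mnm1E eqxx.
have le_Um : (U_(i) <= m)%MM by apply/mnm_lepP => j; rewrite mnm1E; case: eqP => [<-|].
have lt1 : (mdeg (U_(i))%MM < (mdeg m).+1)%N.
  by rewrite -(submK le_Um) mdegD ltnS leq_addl.
have lt2 : (mdeg (m - U_(i))%MM < (mdeg m).+1)%N.
  by rewrite -{2}(submK le_Um) mdegD ltnS leq_addr.
rewrite (bigD1 (BMultinom lt1, BMultinom lt2)) /=; last first.
  by rewrite addmC submK.
rewrite eqxx mul1r big1 ?addr0 // => -[[d1 h1] [d2 h2]] /= /andP[/eqP E ne].
case: eqP => [Ed|_]; last by rewrite mul0r.
case/eqP: ne; congr (_, _); apply/val_inj => //=.
by rewrite E Ed addmC addmK.
Qed.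

Lemma pcoef_pvarXM i j f m :
  pcoef (pvar k i ^+ j * f) m = if (j <= m i)%N then pcoef f (m - U_(i) *+ j)%MM else 0.
Proof.
elim: j m => [|j IHj] m; first by rewrite expr0 mul1r mulm0n subm0.
rewrite exprS -mulrA pcoef_pvarM IHj mnmBE mnm1E eqxx.
case: (posnP (m i)) => [-> //|mi].
rewrite leq_subRL // add1n; case: ifP => // _; congr pcoef.
by apply/mnmP => l; rewrite !(mnmBE, mulmnE); lia.
Qed.

Lemma pvarX_dvd i j f :
  (forall m, (m i < j)%N -> pcoef f m = 0) -> exists g, f = pvar k i ^+ j * g.
Proof.
move=> f0; exists (PowSer (fun m => pcoef f (m + U_(i) *+ j)%MM)).
apply: powserP => m; rewrite pcoef_pvarXM /=; case: leqP => [le_jm|/f0 //].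
congr pcoef; apply/mnmP => l; rewrite mnmDE mnmBE !mulmnE mnm1E.
by case: eqP => [<-|_]; rewrite ?muln0 ?subn0 ?addn0 // !mul1n subnK.
Qed.

Lemma pvarX_inj i j f g : pvar k i ^+ j * f = pvar k i ^+ j * g -> f = g.
Proof.
move=> E; apply: powserP => m.
have : pcoef (pvar k i ^+ j * f) (m + U_(i) *+ j)%MM =
       pcoef (pvar k i ^+ j * g) (m + U_(i) *+ j)%MM by rewrite E.
by rewrite !pcoef_pvarXM mnmDE mulmnE mnm1E eqxx mul1n leq_addl addmK.
Qed.

(** Each of the j factors of a monomial of f ^+ j has positive degree. *)
Lemma pcoefX_low f j m : pcoef f 0%MM = 0 -> (mdeg m < j)%N -> pcoef (f ^+ j) m = 0.
Proof.
move=> f0; elim: j m => // j IHj m lt_mj.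
rewrite exprS pcoefM big1 // => -[[d1 h1] [d2 h2]] /= /eqP E.
have [/eqP|d1_gt0] := posnP (mdeg d1).
  by rewrite mdeg_eq0 => /eqP ->; rewrite f0 mul0r.
by rewrite IHj ?mulr0 //; move: lt_mj; rewrite E mdegD; lia.
Qed.

(** The inverse of 1 - g, with g(0) = 0, is the geometric series in g: each of its
    coefficients is a finite sum because g ^+ j has no term of degree below j. *)
Lemma pcoef0_1_inv f : pcoef f 0%MM = 1 -> exists f', f * f' = 1.
Proof.
move=> f0; pose g := 1 - f.
have g0 : pcoef g 0%MM = 0 by rewrite pcoefD pcoef1 eqxx pcoefN f0 subrr.
pose part d : powser n k := \sum_(j < d.+1) g ^+ j.
exists (PowSer (fun m => pcoef (part (mdeg m)) m)); apply: powserP => m.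
have partE d : (1 - g) * part d = 1 - g ^+ d.+1.
  rewrite /part -[1 - g]opprB mulNr -subrX1 opprB //.
rewrite (@pcoefM_eq f (1 - g) _ (part (mdeg m))) => [|m' _|m' le_m'].
- by rewrite partE pcoefD pcoefN pcoefX_low ?subr0.
- by rewrite /g opprB addrC subrK.
rewrite /= /part !pcoef_sum -!(big_mkord xpredT (fun j => pcoef (g ^+ j) m')).
rewrite [RHS](big_cat_nat _ (n := (mdeg m').+1)) //= [X in _ + X]big_nat_cond.
by rewrite [X in _ + X]big1 ?addr0 // => j /andP[/andP[lt_m'j _] _]; exact: pcoefX_low.
Qed.
End PowerSeries.

Lemma powser_unit n (k : fieldType) (f : powser n k) :
  pcoef f 0%MM != 0 -> exists f', f * f' = 1.
Proof.
move=> f0; have [|f' E] := @pcoef0_1_inv _ _ ((pcoef f 0%MM)^-1 *: f).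
  by rewrite pcoefZ mulVf.
by exists ((pcoef f 0%MM)^-1 *: f'); rewrite -scalerAr scalerAl.
Qed.

Section MonomialIdeal.
Variables (n : nat) (k : comNzRingType) (i j : 'I_n) (a : nat).

(** Membership in this ideal is a condition on coefficients, so it survives cancelling
    any other variable. *)
Lemma pvar_ideal2P f :
  (exists c d, f = c * pvar k i + d * pvar k j ^+ a) <->
  (forall m : 'X_{1..n}, m i = 0%N -> (m j < a)%N -> pcoef f m = 0).
Proof.
split=> [[c [d ->]] m mi mj|f0].
  rewrite pcoefD mulrC pcoef_pvarM mi ltnn add0r mulrC pcoef_pvarXM.
  by rewrite leqNgt mj.
pose f1 := PowSer (fun m => if m i == 0%N then 0 else pcoef f m).
have [g1 E1] : exists g, f1 = pvar k i ^+ 1 * g.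
  by apply: pvarX_dvd => m /=; rewrite ltnS leqn0 => ->.
have [g2 E2] : exists g, f - f1 = pvar k j ^+ a * g.
  apply: pvarX_dvd => m mj; rewrite pcoefD pcoefN /=; case: eqP => mi.
    by rewrite subr0 f0.
  by rewrite subrr.
by exists g1, g2; rewrite mulrC -E1 [g2 * _]mulrC -E2 addrC subrK.
Qed.
End MonomialIdeal.

(** * Expansions in a discrete valuation ring with residue field k *)

Section Expansion.
Variables (k : fieldType) (V : dvr k).
Local Notation t := (dvr_unif V).

Lemma dvr_mul_eq0 (u v : V) : u * v = 0 -> u = 0 \/ v = 0.
Proof. by have [dom _ _ _ _] := dvrP V => /dom/orP[]/eqP; [left|right]. Qed.

Lemma dvr_mulI (u v w : V) : u != 0 -> u * v = u * w -> v = w.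
Proof.
move=> u0 /eqP; rewrite -subr_eq0 -mulrBr => /eqP/dvr_mul_eq0[E|/eqP].
  by rewrite E eqxx in u0.
by rewrite subr_eq0 => /eqP.
Qed.

Lemma dvr_unif_neq0 : t != 0.
Proof. by have [] := dvrP V. Qed.

Lemma dvr_unif_nunit (v : V) : t * v != 1.
Proof.
have [_ _ [_ not1 _] _ _] := dvrP V.
by apply/eqP => E; apply: not1; exists v; rewrite mulrC.
Qed.

Lemma dvr_expand (v : V) : exists cw : k * V, v = cw.1%:A + t * cw.2.
Proof.
have [c _ cK] := dvr_residue V.
have /mod_pi_eq[w E] := esym (cK (mod_pi t (v : V^o))).
by exists (c (mod_pi t (v : V^o)), w); rewrite /= [t * w](esym E) addrC subrK.
Qed.
Definition dhead (v : V) : k := (projT1 (cid (dvr_expand v))).1.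
Definition dtail (v : V) : V := (projT1 (cid (dvr_expand v))).2.
Lemma dheadE v : v = (dhead v)%:A + t * dtail v.
Proof. exact: (projT2 (cid (dvr_expand v))). Qed.

Lemma dvr_expand_inj c v c' v' :
  c%:A + t * v = c'%:A + t * v' :> V -> c = c' /\ v = v'.
Proof.
move=> E; suff Ec : c = c'.
  by split=> //; move: E; rewrite Ec => /addrI/(dvr_mulI dvr_unif_neq0).
have [g cK _] := dvr_residue V; rewrite -[c]cK -[c']cK; congr g.
apply/mod_pi_eq; exists (v' - v); rewrite [RHS]mulrBr.
by rewrite -(addrK (t * v) (c%:A : V)) E; ring.
Qed.

Lemma dhead_lin c u v : dhead (c *: u + v) = c * dhead u + dhead v.
Proof.
apply: (proj1 (@dvr_expand_inj _ (dtail (c *: u + v)) _ (c *: dtail u + dtail v) _)).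
rewrite -dheadE mulrDr -scalerAr scalerDl -scalerA addrACA -scalerDr.
by rewrite -!dheadE.
Qed.
Lemma dtail_lin c u v : dtail (c *: u + v) = c *: dtail u + dtail v.
Proof.
apply: (proj2 (@dvr_expand_inj (dhead (c *: u + v)) _ (c * dhead u + dhead v) _ _)).
rewrite -dheadE mulrDr -scalerAr scalerDl -scalerA addrACA -scalerDr.
by rewrite -!dheadE.
Qed.
Lemma dhead_unif v : dhead (t * v) = 0.
Proof.
by apply: (proj1 (@dvr_expand_inj _ (dtail (t * v)) _ v _));
  rewrite -dheadE scale0r add0r.
Qed.
Lemma dtail_unif v : dtail (t * v) = v.
Proof.
by apply: (proj2 (@dvr_expand_inj (dhead (t * v)) _ 0 _ _));
  rewrite -dheadE scale0r add0r.
Qed.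
Lemma dhead1 : dhead 1 = 1.
Proof.
by apply: (proj1 (@dvr_expand_inj _ (dtail 1) _ 0 _));
  rewrite -dheadE scale1r mulr0 addr0.
Qed.

Lemma dtail1 : dtail 1 = 0.
Proof.
by apply: (proj2 (@dvr_expand_inj (dhead 1) _ 1 _ _));
  rewrite -dheadE scale1r mulr0 addr0.
Qed.

(** The coefficient of t ^+ n in the t-adic expansion of v. *)
Definition dcoef n (v : V) : k := dhead (iter n dtail v).

Lemma dcoef_lin n c u v : dcoef n (c *: u + v) = c * dcoef n u + dcoef n v.
Proof.
rewrite /dcoef; suff -> : iter n dtail (c *: u + v) = c *: iter n dtail u + iter n dtail v.
  exact: dhead_lin.
by elim: n => //= n ->; rewrite dtail_lin.
Qed.
Lemma dcoef0 n : dcoef n 0 = 0.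
Proof. by have := dcoef_lin n (-1) 0 0; rewrite scaler0 addr0 mulN1r addNr. Qed.
Lemma dcoefD n u v : dcoef n (u + v) = dcoef n u + dcoef n v.
Proof. by rewrite -[u]scale1r dcoef_lin mul1r scale1r. Qed.
Lemma dcoefZ n c v : dcoef n (c *: v) = c * dcoef n v.
Proof. by rewrite -[c *: v]addr0 dcoef_lin dcoef0 addr0. Qed.
Lemma dcoefXM p n v : dcoef (p + n) (t ^+ p * v) = dcoef n v.
Proof.
elim: p => [|p IHp]; first by rewrite expr0 mul1r.
by rewrite exprS -mulrA addSn /dcoef iterSr dtail_unif.
Qed.
Lemma dcoefXM_low p n v : (n < p)%N -> dcoef n (t ^+ p * v) = 0.
Proof.
elim: p n => // p IHp [|n] lt_np; rewrite exprS -mulrA /dcoef /= ?dhead_unif //.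
by rewrite -iterS iterSr dtail_unif; exact: IHp.
Qed.

Lemma dcoefX n i : dcoef n (t ^+ i) = (n == i)%:R.
Proof.
rewrite -[t ^+ i]mulr1; case: (ltngtP n i) => [/dcoefXM_low -> //|lt_in|->].
  rewrite -(subnKC (ltnW lt_in)) dcoefXM; move: lt_in; rewrite -subn_gt0.
  by case: (n - i)%N => // j _; rewrite /dcoef iterSr dtail1; exact: dcoef0.
by rewrite -{1}[i]addn0 dcoefXM /dcoef /= dhead1.
Qed.

Lemma dcoef_eq0_dvd n v : (forall i, (i < n)%N -> dcoef i v = 0) ->
  exists w, v = t ^+ n * w.
Proof.
elim: n v => [|n IHn] v v0; first by exists v; rewrite expr0 mul1r.
have [|w E] := IHn (dtail v); first by move=> i lt_in; have := v0 i.+1 lt_in; rewrite /dcoef iterSr.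
by exists w; rewrite [v]dheadE [dhead v](v0 0%N) // scale0r add0r E exprS mulrA.
Qed.

(** Krull's intersection theorem: the generator s of the intersection of the t^n V
    satisfies s = t * (c * s). *)
Lemma dvr_separated v : (forall n, exists w, v = t ^+ n * w) -> v = 0.
Proof.
move=> vI; pose I v := forall n, exists w : V, v = t ^+ n * w.
have I_ideal : is_ideal I.
  split=> [n|u w uI wI n|a u uI n]; first by exists 0; rewrite mulr0.
    have [u' ->] := uI n; have [w' ->] := wI n; by exists (u' + w'); rewrite mulrDr.
  by have [u' ->] := uI n; exists (a * u'); rewrite mulrCA.
have [_ pid _ _ _] := dvrP V; have [s sI] := pid _ I_ideal.
have [s' Es] : exists s', s = t * s'.
  by have /sI/(_ 1%N) : principal s s by exists 1; rewrite mul1r.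
have /sI[c Ec] : I s'.
  move=> n; have /sI/(_ n.+1)[w] : principal s s by exists 1; rewrite mul1r.
  rewrite {1}Es exprS -mulrA => /(dvr_mulI dvr_unif_neq0) ->; by exists w.
have s0 : s = 0.
  have : (1 - t * c) * s = 0 by rewrite mulrBl mul1r -mulrA -Ec -Es subrr.
  case/dvr_mul_eq0 => // /eqP; rewrite subr_eq0 eq_sym => E.
  by have := dvr_unif_nunit c; rewrite E.
by have /sI[a ->] := vI; rewrite s0 mulr0.
Qed.

Lemma dcoef_neq0 v : v != 0 -> exists n, dcoef n v != 0.
Proof.
move=> v0; apply: contrapT => vn; case/eqP: v0; apply: dvr_separated => n.
by apply: dcoef_eq0_dvd => i _; apply/eqP/negP => /negP h; apply: vn; exists i.
Qed.

(** The coefficient of t ^+ n of a Laurent expansion, for n >= 0 only: this is enough to detect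
    elements of V inside V_t. *)
Definition lcoef n (x : dvr_loc V) : k :=
  dcoef (n + (loc_repr x).2) ((loc_repr x).1 : V).

Lemma lcoef_frac n v i : lcoef n (dvr_frac v i) = dcoef (n + i) v.
Proof.
rewrite /lcoef; have := loc_reprK (dvr_frac v i).
case: (loc_repr _) => w j /= /fracP[p E]; have {}E : t ^+ (p + i) * w = t ^+ (p + j) * v by exact: E.
by rewrite -(dcoefXM (p + i)) E -(dcoefXM (p + j) (n + i)); congr dcoef; lia.
Qed.
Lemma lcoefD n x y : lcoef n (x + y) = lcoef n x + lcoef n y.
Proof.
elim/loc_ind: x => v i; elim/loc_ind: y => w j.
rewrite fracD -!/(dvr_frac _ _) !lcoef_frac.
rewrite -[t ^+ j *: _]/(t ^+ j * v) -[t ^+ i *: _]/(t ^+ i * w).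
rewrite dcoefD; congr (_ + _).
  by rewrite -(dcoefXM j (n + i)); congr dcoef; lia.
by rewrite -(dcoefXM i (n + j)); congr dcoef; lia.
Qed.
Lemma lcoefZ n c x : lcoef n (c *: x) = c * lcoef n x.
Proof.
elim/loc_ind: x => v i.
rewrite -/(dvr_frac _ _) -[c *: _]mulr_algl dvr_frac_alg dvr_fracM !lcoef_frac add0n.
by rewrite mulr_algl dcoefZ.
Qed.
Lemma lcoef0 n : lcoef n 0 = 0.
Proof. by have := lcoefD n 0 0; rewrite addr0 -{1}[lcoef n 0]addr0 => /addrI <-. Qed.
End Expansion.

(** * Coefficients of elements of M (x) V_t *)

Section Slices.
Variables (k : fieldType) (R : comAlgType k) (V : dvr k) (M : lmodType R).
Local Notation t := (dvr_unif V).
Local Notation Vt := (dvr_loc V).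
Local Notation W := (tensM M Vt^o).
Local Notation Mk := (restrict (GRing.in_alg R) M).
Local Notation Vk := (restrict (GRing.in_alg Vt) Vt^o).
Local Notation pureM := (@pureM k R Vt M Vt^o).
Implicit Types (m : M) (r : R) (v : V) (x : Vt).

Lemma pureMDl m m' x : pureM (m + m') x = pureM m x + pureM m' x :> W.
Proof. exact: (@pureDl k Mk Vk). Qed.
Lemma pureMDr m x x' : pureM m (x + x') = pureM m x + pureM m x' :> W.
Proof. exact: (@pureDr k Mk Vk). Qed.
Lemma pureM0l x : pureM 0 x = 0 :> W.
Proof. exact: (@pure0l k Mk Vk). Qed.
Lemma pureM0r m : pureM m 0 = 0 :> W.
Proof. exact: (@pure0r k Mk Vk). Qed.
Lemma pureM_suml I (s : seq I) (F : I -> M) x :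
  pureM (\sum_(i <- s) F i) x = \sum_(i <- s) pureM (F i) x :> W.
Proof. exact: (@pure_suml k Mk Vk). Qed.
Lemma pureMZ (c : k) m x : pureM (c%:A *: m) x = pureM m (c *: x) :> W.
Proof. by rewrite -[c *: x]mulr_algl; exact: (@pureZ k Mk Vk c m x). Qed.

Lemma tensM_ind (P : W -> Prop) : P 0 ->
  (forall w w', P w -> P w' -> P (w + w')) -> (forall m x, P (pureM m x)) -> forall w, P w.
Proof. exact: (@tens_ind k Mk Vk). Qed.

(** The coefficient of t ^+ n of an element of M (x) V_t. *)
Definition slice n (w : W) : M := @tens_lift k Mk Vk M (fun m x => (lcoef n x)%:A *: (m : M)) w.

Fact slice_bal n : balanced (fun (m : Mk) (x : Vk) => (lcoef n x)%:A *: (m : M)).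
Proof.
split=> [m m' x|m x x'|c m x]; first by rewrite scalerDr.
  by rewrite lcoefD scalerDl scalerDl.
have -> : c *: x = (c *: (x : Vt) : Vt) :> Vt by exact: mulr_algl.
rewrite -[LHS]/((lcoef n x)%:A *: (c%:A *: (m : M))) lcoefZ scalerA mulr_algl scalerA.
by rewrite mulrC.
Qed.

Lemma slice_pure n m x : slice n (pureM m x) = (lcoef n x)%:A *: m.
Proof. exact: (tens_lift_pure (slice_bal n)). Qed.
Lemma sliceD n w w' : slice n (w + w') = slice n w + slice n w'.
Proof. exact: (tens_liftD (slice_bal n)). Qed.
Lemma slice0 n : slice n 0 = 0.
Proof. exact: (tens_lift0 (slice_bal n)). Qed.
Lemma slice_sum n I (s : seq I) (F : I -> W) :
  slice n (\sum_(i <- s) F i) = \sum_(i <- s) slice n (F i).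
Proof. by apply: (big_morph (slice n)); [exact: sliceD | exact: slice0]. Qed.
Lemma sliceZ n r w : slice n (pureA r 1 *: w) = r *: slice n w.
Proof.
elim/tensM_ind: w => [|w w' IH IH'|m x]; first by rewrite scaler0 slice0 scaler0.
  by rewrite scalerDr !sliceD IH IH' scalerDr.
rewrite tensM_scale scale1r !slice_pure.
by rewrite !scalerA mulrC.
Qed.

(** The image of a finite sum of tensors under M (x) V -> M (x) V_t. *)
Definition integral_tensor (s : seq (M * V)) : W :=
  \sum_(p <- s) pureM p.1 (dvr_frac p.2 0).

Lemma frac0D v v' : dvr_frac (v + v') 0 = dvr_frac v 0 + dvr_frac v' 0 :> Vt.
Proof. by rewrite [RHS]fracDn. Qed.
Lemma frac0Z (c : k) v : dvr_frac (c *: v) 0 = c *: dvr_frac v 0 :> Vt.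
Proof. by rewrite -[c *: dvr_frac _ _]mulr_algl dvr_frac_alg dvr_fracM mulr_algl. Qed.
Lemma frac00 : dvr_frac 0 0 = 0 :> Vt.
Proof. by rewrite -(scale0r 0) frac0Z scale0r. Qed.

(** If all coefficients of a tensor lie in the submodule D, it comes from D (x) V. Take a term
    m (x) v with v <> 0 and a coefficient c of v that is not zero. The corresponding slice is
    c m plus a combination of the other m_i, and lies in D; it replaces m if the other v_i are
    changed by multiples of v. This leaves a shorter sum. *)
Lemma integral_slices (D : M -> Prop) (s : seq (M * V)) :
    D 0 -> (forall m m', D m -> D m' -> D (m + m')) -> (forall r m, D m -> D (r *: m)) ->
    (forall n, D (slice n (integral_tensor s))) ->
  exists2 s', integral_tensor s = integral_tensor s' & forall p, p \in s' -> D p.1.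
Proof.
move=> D0 DD DZ; have [N] := ubnP (size s); elim: N s => // N IHN [|[m v] s] /= ltN Ds.
  by exists [::].
have [Ev|v0] := eqVneq v 0.
  rewrite /integral_tensor big_cons /= Ev frac00 pureM0r add0r; apply: IHN => // n.
  by have := Ds n; rewrite /integral_tensor big_cons /= Ev sliceD slice_pure frac00 lcoef0 !scale0r add0r.
have [n cn0] := dcoef_neq0 v0; set c := dcoef n v in cn0.
pose a (p : M * V) := dcoef n p.2 / c.
(* m' is the n-th slice of the sum, divided by c *)
pose m' := m + \sum_(p <- s) (a p)%:A *: p.1.
pose s1 := [seq (p.1, p.2 - a p *: v) | p <- s].
have Dm' : D m'.
  have := DZ (c^-1)%:A _ (Ds n); congr (D _).
  rewrite /integral_tensor big_cons sliceD slice_sum scalerDr /m'; congr (_ + _).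
    by rewrite slice_pure lcoef_frac addn0 scalerA mulr_algl scalerA mulVf // scale1r scale1r.
  rewrite scaler_sumr; apply: eq_bigr => p _.
  by rewrite slice_pure lcoef_frac addn0 scalerA mulr_algl scalerA mulrC.
have E : integral_tensor ((m, v) :: s) = pureM m' (dvr_frac v 0) + integral_tensor s1.
  rewrite /integral_tensor big_cons big_map /= pureMDl -addrA; congr (_ + _).
  rewrite pureM_suml -big_split /=; apply: eq_bigr => p _.
  by rewrite pureMZ -frac0Z -pureMDr -frac0D addrC subrK.
have [||s' Es' Ds'] := IHN s1; first by rewrite size_map.
  move=> l; have := DD _ _ (Ds l) (DZ (-1) _ (DZ (lcoef l (dvr_frac v 0))%:A _ Dm')).
  congr (D _); rewrite E sliceD slice_pure scaleN1r addrAC subrr add0r.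
  by [].
exists ((m', v) :: s').
  by rewrite E Es' /integral_tensor big_cons.
by move=> p; rewrite inE => /orP[/eqP->|/Ds'].
Qed.


Lemma integral_kernel_sub w s r r' (l : seq (M * V)) :
    kernel_sub M w s r r' -> pureA r 1 *: integral_tensor l = 0 ->
  exists2 l', pureA w 1 *: integral_tensor l = pureA s 1 *: integral_tensor l'
            & pureA r' 1 *: integral_tensor l' = 0.
Proof.
move=> sol E; have [|||n|l1 -> Dl1] := @integral_slices (fun m => r *: m = 0) l.
- exact: scaler0.
- by move=> m m' Em Em'; rewrite scalerDr Em Em' addr0.
- by move=> a m Em; rewrite scalerA mulrC -scalerA Em scaler0.
- by rewrite -sliceZ E slice0.
elim: l1 Dl1 => [|[m v] l1 IH] Dl1.
  by exists [::]; rewrite /integral_tensor !big_nil !scaler0.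
have [|l2 E2 E2'] := IH; first by move=> p pl; apply: Dl1; rewrite inE pl orbT.
have [m' Em Em'] := sol m (Dl1 (m, v) (mem_head _ _)).
exists ((m', v) :: l2); rewrite /integral_tensor !big_cons !scalerDr -!/(integral_tensor _).
  by rewrite E2 !tensM_scale Em.
by rewrite E2' tensM_scale Em' pureM0l addr0.
Qed.

End Slices.

(** * Relations pass from M to a lattice *)

(** Q is a family over the parameter t, without t-torsion, with special fibre N. *)
Record specialization (R T : comPzRingType) (iota : {rmorphism R -> T}) (t : T)
    (Q : lmodType T) (N : lmodType R) (pi : Q -> N) : Prop := Specialization {
  spD : forall q q', pi (q + q') = pi q + pi q';
  spZ : forall r q, pi (iota r *: q) = r *: pi q;
  sp_surj : forall n, exists q, pi q = n;
  sp_ker : forall q, pi q = 0 <-> exists q', q = t *: q';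
  sp_tf : forall q : Q, t *: q = 0 -> q = 0 }.

(** Apply flatness to the injection v |-> t v of V into itself. *)
Lemma flat_torsion_free (k : fieldType) (V : dvr k) (M : lmodType V) (m : M) :
  flat M -> dvr_unif V *: m = 0 -> m = 0.
Proof.
set t := dvr_unif V => flatM tm0.
pose f : V^o -> V^o := fun v => t * v.
have f_lin : linear f.
  by move=> a u v; rewrite /f mulrDr; congr (_ + _); rewrite -[a *: u]/(a * u) mulrCA.
pose F := GRing.isLinear.Build _ _ _ _ f f_lin.
pose fL : {linear V^o -> V^o} := HB.pack f F.
have f_inj : injective fL by move=> u v; exact: (dvr_mulI (dvr_unif_neq0 V)).
have := flatM _ _ fL f_inj (pure m (1 : V^o)) (pure (0 : M) (1 : V^o)).
have bal : balanced (fun (n : M) (x : V^o) => pure n (fL x)).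
  split=> [n n' x|n x x'|a n x]; rewrite ?pureDl //.
    by rewrite raddfD pureDr.
  by rewrite pureZ linearZ.
rewrite /tens_map !tens_lift_pure //.
have -> : fL 1 = t *: (1 : V^o) by rewrite /= /f.
rewrite -!pureZ tm0 scaler0 => /(_ erefl) E.
have balm : balanced (fun (n : M) (x : V^o) => (x : V) *: n).
  split=> [n n' x|n x x'|a n x]; first exact: scalerDr.
    exact: scalerDl.
  by rewrite -[a *: x]/(a * x) scalerA mulrC.
have := congr1 (tens_lift (fun (n : M) (x : V^o) => (x : V) *: n)) E.
by rewrite !tens_lift_pure // !scale1r.
Qed.

Section LatticeTransfer.
Variables (k : fieldType) (R : comAlgType k) (V : dvr k).
Local Notation t := (dvr_unif V).
Local Notation Vt := (dvr_loc V).
Local Notation T := (tensA R V).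
Local Notation tau := (inr_alg R t).

Lemma inr_algX (v : V) l : inr_alg R v ^+ l = inr_alg R (v ^+ l).
Proof. by rewrite rmorphXn. Qed.

Section Localize.
Variable Q : lmodType T.

Lemma mod_fracD (q q' : Q) i : mod_frac (q + q') i = mod_frac q i + mod_frac q' i.
Proof. by rewrite [RHS]fracDn. Qed.

Hypothesis Q_tf : forall q : Q, tau *: q = 0 -> q = 0.

Lemma torsion_freeX l (q : Q) : tau ^+ l *: q = 0 -> q = 0.
Proof. by elim: l q => [|l IHl] q; rewrite ?scale1r // exprSr -scalerA => /IHl/Q_tf. Qed.

Lemma mod_frac_inj : injective (fun q : Q => mod_frac q 0).
Proof.
move=> q q' /fracP[p]; rewrite !addn0 => E.
apply/eqP; rewrite -subr_eq0; apply/eqP/(@torsion_freeX p).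
by rewrite scalerBr !inr_algX; apply/eqP; rewrite subr_eq0; apply/eqP; exact: E.
Qed.
End Localize.

Variables (M : lmodType R) (Q : lmodType T).
Local Notation W := (tensM M Vt^o).
Local Notation pureM := (@pureM k R Vt M Vt^o).

(* E is the embedding of Q in W = M (x) V_t *)
Variable phi : {linear mod_loc Q -> W}.
Let E (q : Q) : W := phi (mod_frac q 0).

Let ED q q' : E (q + q') = E q + E q'.
Proof. by rewrite /E mod_fracD raddfD. Qed.
Let E0 : E 0 = 0.
Proof. by apply: (addrI (E 0)); rewrite -ED !addr0. Qed.
Let Ez r v q : E (pureA r v *: q) = pureA r (dvr_frac v 0) *: E q.
Proof. by rewrite /E -[RHS]linearZ /= mod_loc_scale. Qed.

Local Notation integral := (@integral_tensor k R V M).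

Let integral_cat s s' : integral (s ++ s') = integral s + integral s'.
Proof. exact: big_cat. Qed.
Let integral_act r v s : exists s', pureA r (dvr_frac v 0) *: integral s = integral s'.
Proof.
exists [seq (r *: p.1, v * p.2) | p <- s]; rewrite /integral_tensor big_map scaler_sumr.
by apply: eq_bigr => p _; rewrite tensM_scale /= -[0%N in RHS]addn0 -dvr_fracM.
Qed.

Let bounded_in (w : W) l := exists s, pureA 1 (dvr_frac (t ^+ l) 0) *: w = integral s.
Let bounded_inW w l l' : (l <= l')%N -> bounded_in w l -> bounded_in w l'.
Proof.
move=> le_l [s Es]; have [s' Es'] := integral_act 1 (t ^+ (l' - l)) s.
exists s'; rewrite -Es' -Es scalerA pureAM mulr1 dvr_fracM -exprD; congr (pureA _ (dvr_frac (t ^+ _) _) *: _).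
by rewrite subnK.
Qed.
Let bounded_inD w w' l : bounded_in w l -> bounded_in w' l -> bounded_in (w + w') l.
Proof. by move=> [s Es] [s' Es']; exists (s ++ s'); rewrite scalerDr Es Es' integral_cat. Qed.
Let bounded_in_ex w : exists l, bounded_in w l.
Proof.
elim/tensM_ind: w => [|w w' [l h] [l' h']|m x].
- by exists 0%N, [::]; rewrite scaler0 /integral_tensor big_nil.
- exists (maxn l l'); apply: bounded_inD.
    exact: bounded_inW (leq_maxl _ _) h.
  exact: bounded_inW (leq_maxr _ _) h'.
elim/loc_ind: x => v i; exists i, [:: (m, v)].
rewrite tensM_scale scale1r /integral_tensor big_seq1 /=.
congr (Defs.pureM _ _); rewrite -[_ *: _]/(dvr_frac (t ^+ i) 0 * dvr_frac v i) dvr_fracM.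
by rewrite add0n -[RHS](frac_shift t i) addn0.
Qed.

(** Q lies in t^-l times the image of M (x) V: clear the denominators of finitely many generators. *)
Lemma lattice_denominator : fin_gen Q ->
  exists l, forall q, exists s, pureA 1 (dvr_frac (t ^+ l) 0) *: E q = integral s.
Proof.
move=> [gens genQ].
have [l hl] : exists l, forall i, (i < size gens)%N -> bounded_in (E gens`_i) l.
  elim: (gens) => [|q gens' [l hl]]; first by exists 0%N.
  have [l' hl'] := bounded_in_ex (E q); exists (maxn l l') => -[_|i /hl h] /=.
    exact: bounded_inW (leq_maxr _ _) hl'.
  exact: bounded_inW (leq_maxl _ _) h.
exists l => q; rewrite -/(bounded_in _ _).
have /asboolP[c ->] := genQ q; rewrite -/(bounded_in _ _).
elim/big_ind: _ => [|q1 q2|i _].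
- by exists [::]; rewrite E0 scaler0 /integral_tensor big_nil.
- by rewrite ED; exact: bounded_inD.
elim/(@tens_ind k R V): (c i) => [|a b ha hb|r v].
- by exists [::]; rewrite scale0r E0 scaler0 /integral_tensor big_nil.
- by rewrite scalerDl ED; exact: bounded_inD.
have [s Es] := hl i (ltn_ord i); have [s' Es'] := integral_act r v s.
by exists s'; rewrite -[pure r v]/(pureA r v) Ez scalerA mulrC -scalerA Es Es'.
Qed.

Hypothesis phi_surj : forall w, exists y, phi y = w.

Let inE_D l w w' : (exists q, E q = pureA 1 (dvr_frac (t ^+ l) 0) *: w) ->
  (exists q, E q = pureA 1 (dvr_frac (t ^+ l) 0) *: w') ->
  (exists q, E q = pureA 1 (dvr_frac (t ^+ l) 0) *: (w + w')).
Proof. by move=> [q Eq] [q' Eq']; exists (q + q'); rewrite ED Eq Eq' scalerDr. Qed.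

(** Dually, t^l times the image of M (x) V lies in Q. *)
Lemma standard_denominator : fin_gen M ->
  exists l, forall s, exists q, E q = pureA 1 (dvr_frac (t ^+ l) 0) *: integral s.
Proof.
move=> [gens genM].
pose inE l w := exists q, E q = pureA 1 (dvr_frac (t ^+ l) 0) *: w.
have inE_W w l l' : (l <= l')%N -> inE l w -> inE l' w.
  move=> le_l [q Eq]; exists (pureA 1 (t ^+ (l' - l)) *: q); rewrite Ez Eq.
  rewrite scalerA pureAM mulr1 dvr_fracM -exprD.
  by congr (pureA _ (dvr_frac (t ^+ _) _) *: _); rewrite subnK.
have inE_ex w : exists l, inE l w.
  have [y <-] := phi_surj w; elim/mod_loc_ind: y => q i; exists i, q.
  rewrite -[RHS]linearZ /= mod_loc_scale add0n; congr (phi _).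
  rewrite -[RHS](_ : mod_frac (pureA 1 (t ^+ i) *: q) (i + 0) = _); last by rewrite addn0.
  by rewrite [RHS](frac_shift t i).
have [l hl] : exists l, forall i, (i < size gens)%N -> inE l (pureM gens`_i 1).
  elim: (gens) => [|m gens' [l hl]]; first by exists 0%N.
  have [l' hl'] := inE_ex (pureM m 1); exists (maxn l l') => -[_|i /hl h] /=.
    exact: inE_W (leq_maxr _ _) hl'.
  exact: inE_W (leq_maxl _ _) h.
exists l; elim=> [|[m v] s IHs].
  by exists 0; rewrite E0 /integral_tensor big_nil scaler0.
rewrite /integral_tensor big_cons /=; apply: inE_D => //.
have /asboolP[c ->] := genM m; rewrite -/(inE _ _).
elim/big_ind: _ => [|m1 m2|i _].
- by exists 0; rewrite E0 pureM0l scaler0.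
- by rewrite pureMDl; exact: inE_D.
have [q Eq] := hl i (ltn_ord i); exists (pureA (c i) v *: q).
rewrite Ez Eq scalerA mulrC -scalerA tensM_scale; congr (_ *: Defs.pureM _ _).
by rewrite -[RHS]mulr1.
Qed.

Hypothesis Q_tf : forall q : Q, tau *: q = 0 -> q = 0.
Hypothesis phi_inj : injective phi.

Let E_inj : injective E.
Proof. by move=> q q' /phi_inj/(mod_frac_inj Q_tf). Qed.

Lemma lattice_kernel_sub w s r r' : fin_gen Q -> fin_gen M -> kernel_sub M w s r r' ->
  exists l, kernel_sub Q (tau ^+ l * inl_alg V w) (inl_alg V s) (inl_alg V r) (inl_alg V r').
Proof.
move=> fgQ fgM sol; have [l hl] := lattice_denominator fgQ.
have [l' hl'] := standard_denominator fgM.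
exists (l' + l)%N => q rq0; have [c Ec] := hl q.
have E1 a x : E (inl_alg V a *: x) = pureA a 1 *: E x by exact: Ez.
have Et i x : E (tau ^+ i *: x) = pureA 1 (dvr_frac (t ^+ i) 0) *: E x.
  by rewrite inr_algX; exact: Ez.
have C (a b : tensA R Vt) (z : W) : a *: (b *: z) = b *: (a *: z) by rewrite !scalerA mulrC.
have rc0 : pureA r 1 *: integral c = 0.
  by rewrite -Ec C -E1 rq0 E0 scaler0.
have [c' Ec' Ec'0] := integral_kernel_sub sol rc0.
have [q' Eq'] := hl' c'; exists q'; apply: E_inj; rewrite E1 Eq'.
  by rewrite C -Ec' -Ec -scalerA exprD -scalerA !Et E1; congr (_ *: _); exact: C.
by rewrite C Ec'0 scaler0 E0.
Qed.
End LatticeTransfer.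

(** This reduces all necessary conditions for a degeneration to a family with special fibre N
    that satisfies the relations of M up to powers of t. *)
Lemma degenerates_specialization (k : fieldType) (R : comAlgType k) (M N : lmodType R) :
    fin_gen M -> degenerates M N ->
  exists (T : comPzRingType) (iota : {rmorphism R -> T}) (t : T) (Q : lmodType T)
      (pi : Q -> N), specialization iota t pi /\
    forall w s r r', kernel_sub M w s r r' ->
      exists l, kernel_sub Q (t ^+ l * iota w) (iota s) (iota r) (iota r').
Proof.
move=> fgM [V [Q [fgQ flatQ [psi psi_bij] [phi phi_bij]]]].
have Q_tf (q : Q) : inr_alg R (dvr_unif V) *: q = 0 -> q = 0.
  exact: (@flat_torsion_free k V (restrict (@inr_alg k R V) Q) q flatQ).
pose pi (q : Q) := psi (mod_pi (inr_alg R (dvr_unif V)) q).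
have piD q q' : pi (q + q') = pi q + pi q' by rewrite /pi mod_piD raddfD.
have pi0 : pi 0 = 0 by apply: (addrI (pi 0)); rewrite -piD !addr0.
exists (tensA R V), (@inl_alg k R V), (inr_alg R (dvr_unif V)), Q, pi.
split; first split=> //.
- by move=> r q; rewrite /pi -mod_piZ -[RHS]linearZ.
- move=> n; have [psi' psiK psi'K] := psi_bij; have [q Eq] := mod_pi_surj (psi' n).
  by exists q; rewrite /pi -Eq psi'K.
- move=> q; have inj := bij_inj psi_bij; split=> [|[q' Eq]]; rewrite -pi0.
    by move=> /inj/mod_pi_eq[q' E]; exists q'; rewrite -E subr0.
  by congr (psi _); apply/mod_pi_eq; exists q'; rewrite subr0.
move=> w s r r'; apply: (@lattice_kernel_sub _ _ _ _ _ phi) => //; last exact: bij_inj.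
by move=> y; have [phi' _ K] := phi_bij; exists (phi' y); rewrite K.
Qed.

(** * Specialization of ker y / im x, and the crossing planes *)

Section Specialization.
Variables (R T : comPzRingType) (iota : {rmorphism R -> T}) (t : T).
Variables (Q : lmodType T) (N : lmodType R) (pi : Q -> N).
Hypothesis sp : specialization iota t pi.
Implicit Types (p q z : Q) (n : N) (a b c : T).

Lemma scaleCA a b q : a *: (b *: q) = b *: (a *: q).
Proof. by rewrite !scalerA mulrC. Qed.
Lemma sp0 : pi 0 = 0.
Proof. by apply: (addrI (pi 0)); rewrite -(spD sp) !addr0. Qed.
Lemma spN q : pi (- q) = - pi q.
Proof. by apply: (addrI (pi q)); rewrite -(spD sp) !subrr sp0. Qed.
Lemma spB q q' : pi (q - q') = pi q - pi q'.
Proof. by rewrite (spD sp) spN. Qed.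
Lemma sp_t q : pi (t *: q) = 0.
Proof. by apply/(sp_ker sp); exists q. Qed.
Lemma sp_eq q q' : pi q = pi q' -> exists z, q = q' + t *: z.
Proof.
move=> E; have /(sp_ker sp)[z Ez] : pi (q - q') = 0 by rewrite spB E subrr.
by exists z; rewrite -Ez addrC subrK.
Qed.
Lemma sp_tI q q' : t *: q = t *: q' -> q = q'.
Proof.
move=> E; apply/eqP; rewrite -subr_eq0; apply/eqP/(sp_tf sp).
by rewrite scalerBr E subrr.
Qed.
Lemma sp_tXI i q q' : t ^+ i *: q = t ^+ i *: q' -> q = q'.
Proof.
by elim: i q q' => [|i IHi] q q'; rewrite ?expr0 ?scale1r // exprSr -!scalerA => /IHi/sp_tI.
Qed.

(** If a acts on the special fibre as an injective endomorphism, then a is a nonzerodivisor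
    modulo every power of t. *)
Lemma fiberwise_reg a (h : N -> N) i q z :
    (forall q', pi (a *: q') = h (pi q')) -> (forall n, h n = 0 -> n = 0) ->
  a *: q = t ^+ i *: z -> exists q', q = t ^+ i *: q'.
Proof.
move=> ha h_inj; elim: i q z => [|i IHi] q z; first by exists q; rewrite scale1r.
rewrite exprS -scalerA => E.
have /h_inj/(sp_ker sp)[q1 Eq1] : h (pi q) = 0 by rewrite -ha E sp_t.
have [q2 Eq2] : exists q', q1 = t ^+ i *: q'.
  by apply: (IHi _ z); apply: sp_tI; rewrite -E Eq1 scaleCA.
by exists q2; rewrite -scalerA -Eq2.
Qed.

(** Elements of ker y on N lift to ker y on Q: if q lifts such an element, then y q = t q1 with
    x q1 = 0, so q1 = y q2 by exactness on Q, and q - t q2 is the required lift. Applying the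
    relation to this lift gives t^l w q in xQ; the factor t^l can be cancelled, since
    t z = x p implies that p is in yQ + tQ, again by ker x = im y on N. *)
Lemma specialize_kernel x y w l l' :
    x * y = 0 -> kernel_sub N 1 y x 0 ->
    kernel_sub Q (t ^+ l * iota 1) (iota y) (iota x) (iota 0) ->
    kernel_sub Q (t ^+ l' * iota w) (iota x) (iota y) (iota 0) ->
  kernel_sub N w x y 0.
Proof.
move=> xy0 exN exQ solQ.
have xyQ q : iota x *: (iota y *: q) = 0 by rewrite scalerA -rmorphM xy0 rmorph0 scale0r.
have lift q : iota x *: q = 0 -> exists q' z, q = iota y *: q' + t *: z /\ iota x *: z = 0.
  move=> xq; have [|n En _] := exN (pi q); first by rewrite -(spZ sp) xq sp0.
  have [q' Eq'] := sp_surj sp n; have [z Ez] : exists z, q = iota y *: q' + t *: z.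
    by apply: sp_eq; rewrite (spZ sp) Eq' -En scale1r.
  exists q', z; split=> //; apply: (sp_tf sp).
  by have := xq; rewrite Ez scalerDr xyQ add0r scaleCA.
(* ker x = im y on Q: the quotient is t-divisible and killed by t^l *)
have kerQ q : iota x *: q = 0 -> exists q', q = iota y *: q'.
  move=> xq; suff [q' [z [-> xz]]] :
      exists q' z, q = iota y *: q' + t ^+ l *: z /\ iota x *: z = 0.
    have [z' Ez' _] := exQ z xz; exists (q' + z').
    by rewrite scalerDr -Ez' rmorph1 mulr1.
  elim: {exQ solQ} l => [|l [q1 [z1 [-> xz1]]]].
    by exists 0, q; rewrite scaler0 add0r scale1r.
  have [q2 [z [-> xz]]] := lift z1 xz1; exists (q1 + t ^+ l *: q2), z; split=> //.
  by rewrite !scalerDr [_ *: (iota y *: q2)]scaleCA addrA [_ *: (t *: z)]scalerA -exprSr.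
move=> n yn0; have [q Eq] := sp_surj sp n.
have [q1 Eq1] : exists q1, iota y *: q = t *: q1.
  by apply/(sp_ker sp); rewrite (spZ sp) Eq.
have [q2 Eq2] : exists q2, q1 = iota y *: q2.
  apply: kerQ; apply: (sp_tf sp).
  by rewrite scaleCA -Eq1 xyQ.
have [|p Ep _] := solQ (q - t *: q2).
  by rewrite scalerBr Eq1 Eq2 scaleCA subrr.
have {Ep} [p' Ep'] : exists p', iota w *: (q - t *: q2) = iota x *: p'.
  elim: {solQ} l' p Ep => [|i IHi] p; first by rewrite mul1r; exists p.
  rewrite exprS -mulrA -scalerA => E.
  have [|n' En' _] := exN (pi p).
    by rewrite -(spZ sp) -E sp_t.
  have [p1 Ep1] := sp_surj sp n'.
  have [p2 Ep2] : exists z, p = iota y *: p1 + t *: z.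
    by apply: sp_eq; rewrite (spZ sp) Ep1 -En' scale1r.
  apply: (IHi p2); apply: sp_tI.
  by rewrite E Ep2 scalerDr xyQ add0r scaleCA.
exists (pi p'); last exact: scale0r.
by rewrite -(spZ sp) -Ep' (spZ sp) spB sp_t subr0 Eq.
Qed.
End Specialization.

Lemma degenerates_kernel (k : fieldType) (R : comAlgType k) (M N : lmodType R) x y w :
    fin_gen M -> degenerates M N -> x * y = 0 ->
    kernel_sub M 1 y x 0 -> kernel_sub N 1 y x 0 ->
  kernel_sub M w x y 0 -> kernel_sub N w x y 0.
Proof.
move=> fgM /(degenerates_specialization fgM)[T [iota [t [Q [pi [sp tr]]]]]] xy0 exM exN solM.
have [l hl] := tr _ _ _ _ exM; have [l' hl'] := tr _ _ _ _ solM.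
exact: (specialize_kernel sp xy0 exN hl hl').
Qed.

Section CrossingPlanes.
Variables (k : fieldType) (R : comAlgType k) (pi : {rmorphism powser 3 k -> R}).
Variables (i j l : 'I_3).
Hypotheses (ij : i != j) (il : i != l) (jl : j != l).
Local Notation X := (pvar k i).
Local Notation Y := (pvar k j).
Local Notation Z := (pvar k l).
Hypothesis pi_surj : forall r, exists p, r = pi p.
Hypothesis pi_ker : forall p, pi p = 0 <-> exists c, p = c * (X * Y).
Local Notation x := (pi X).
Local Notation y := (pi Y).
Local Notation z := (pi Z).

Lemma pi_eq p q : pi p = pi q -> exists c, p = q + c * (X * Y).
Proof.
move=> E; have /pi_ker[c Ec] : pi (p - q) = 0 by rewrite rmorphB E subrr.
by exists c; rewrite -Ec addrC subrK.
Qed.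

Lemma pi_XY : x * y = 0.
Proof. by rewrite -rmorphM; apply/pi_ker; exists 1; rewrite mul1r. Qed.

Lemma crossing_ker_x r : x * r = 0 -> exists p, r = y * pi p.
Proof.
have [p ->] := pi_surj r; rewrite -rmorphM => /pi_ker[c E]; exists c.
rewrite -rmorphM; congr (pi _); apply: (@pvarX_inj _ _ i 1).
by rewrite expr1 E; ring.
Qed.

Lemma crossing_ker_y r : y * r = 0 -> exists p, r = x * pi p.
Proof.
have [p ->] := pi_surj r; rewrite -rmorphM => /pi_ker[c E]; exists c.
rewrite -rmorphM; congr (pi _); apply: (@pvarX_inj _ _ j 1).
by rewrite expr1 E; ring.
Qed.

(** Let m = y p be in (x, z^a). The coefficients of y p without x and with z-degree below a vanish, so
    those of p do too, and p itself is in (x, z^a). *)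
Lemma crossing_exact a : kernel_sub (ideal [:: x; z ^+ a]) 1 y x 0.
Proof.
apply/kernel_sub_ideal => m Im xm; have [p Ep] := crossing_ker_x xm.
exists (pi p); split; [|by rewrite mul1r|exact: mul0r].
have [c [d Ecd]] := Im; have [c' Ec] := pi_surj c; have [d' Ed] := pi_surj d.
have [e Ee] : exists e, Y * p = c' * X + d' * Z ^+ a + e * (X * Y).
  by apply: pi_eq; rewrite !rmorphD !rmorphM rmorphXn -Ep -Ec -Ed.
have p0 (m' : 'X_{1..3}) : m' i = 0%N -> (m' l < a)%N -> pcoef p m' = 0.
  move=> mi ml; have := pcoef_pvarM j p (m' + U_(j))%MM.
  rewrite mnmDE mnm1E eqxx addn1 ltn0Sn addmK => <-.
  have Im2 : exists c d, Y * p = c * X + d * Z ^+ a.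
    by exists (c' + e * Y), d'; rewrite Ee; ring.
  apply: (proj1 (pvar_ideal2P i l a _) Im2); rewrite mnmDE mnm1E.
    by rewrite mi eq_sym (negPf ij).
  by rewrite (negPf jl) addn0.
have [c1 [d1 ->]] := proj2 (pvar_ideal2P i l a p) p0.
by exists (pi c1), (pi d1); rewrite rmorphD !rmorphM rmorphXn.
Qed.

(** Since x is in ker y, it would follow that z^a x lies in x (x, z^b), that is, z^a would be in
    (x, z^b) modulo y. *)
Lemma crossing_not_degenerates a b : (a < b)%N ->
  ~ degenerates (ideal [:: x; z ^+ a]) (ideal [:: x; z ^+ b]).
Proof.
move=> lt_ab deg.
have solM : kernel_sub (ideal [:: x; z ^+ a]) (z ^+ a) x y 0.
  apply/kernel_sub_ideal => m _ /crossing_ker_y[p ->]; exists (z ^+ a * pi p).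
  by split; [exists 0, (pi p); ring | ring | exact: mul0r].
have := degenerates_kernel (ideal2_fin_gen _ _) deg pi_XY
  (@crossing_exact a) (@crossing_exact b) solM.
move=> /kernel_sub_ideal/(_ x)[||m' [Im' E _]].
- by exists 1, 0; ring.
- by rewrite mulrC pi_XY.
have [c [d Ecd]] := Im'; have [c' Ec] := pi_surj c; have [d' Ed] := pi_surj d.
have [e Ee] : exists e, Z ^+ a * X = X * (c' * X + d' * Z ^+ b) + e * (X * Y).
  by apply: pi_eq; rewrite !(rmorphM, rmorphD, rmorphXn) -Ec -Ed -Ecd.
have {}Ee : Z ^+ a = c' * X + d' * Z ^+ b + e * Y.
  by apply: (@pvarX_inj _ _ i 1); rewrite expr1 mulrC Ee; ring.
pose m := (U_(l) *+ a)%MM : 'X_{1..3}.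
have := pcoef_pvarXM l a (1 : powser 3 k) m; rewrite mulr1 Ee.
have mE t : m t = if l == t then a else 0%N.
  by rewrite /m mulmnE mnm1E; case: eqP; rewrite ?mul1n ?mul0n.
have mm0 : (m - U_(l) *+ a)%MM = 0%MM by apply/mnmP => t; rewrite mnmBE mnm0E subnn.
rewrite mE eqxx leqnn mm0 pcoef1 eqxx.
rewrite pcoefD [e * _]mulrC pcoef_pvarM mE eq_sym (negPf jl) addr0.
rewrite (proj1 (pvar_ideal2P i l b _)) ?mE ?[l == i]eq_sym ?(negPf il) ?eqxx //.
  by move/eqP; rewrite eq_sym oner_eq0.
by exists c', d'.
Qed.
End CrossingPlanes.

(** * The length formula, and the double line *)

Section ModEq.
Variables (T : comPzRingType) (t : T) (Q : lmodType T).
Implicit Types (q : Q).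

(** Congruence modulo t^i Q. *)
Definition modeq i q q' := exists z, q = q' + t ^+ i *: z.

Lemma modeq_refl i q : modeq i q q.
Proof. by exists 0; rewrite scaler0 addr0. Qed.
Lemma modeq_sym i q q' : modeq i q q' -> modeq i q' q.
Proof. by move=> [z ->]; exists (- z); rewrite scalerN addrK. Qed.
Lemma modeq_trans i q1 q2 q3 : modeq i q1 q2 -> modeq i q2 q3 -> modeq i q1 q3.
Proof. by move=> [z ->] [z' ->]; exists (z' + z); rewrite scalerDr addrA. Qed.
Lemma modeqD i q1 q2 q1' q2' :
  modeq i q1 q1' -> modeq i q2 q2' -> modeq i (q1 + q2) (q1' + q2').
Proof. by move=> [z ->] [z' ->]; exists (z + z'); rewrite scalerDr addrACA. Qed.
Lemma modeqZ i a q q' : modeq i q q' -> modeq i (a *: q) (a *: q').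
Proof. by move=> [z ->]; exists (a *: z); rewrite scalerDr scaleCA. Qed.
End ModEq.

Section Parity.
Variables (R T : comPzRingType) (iota : {rmorphism R -> T}) (t : T).
Variables (Q : lmodType T) (N : lmodType R) (pi : Q -> N).
Hypothesis sp : specialization iota t pi.
Variables (x y : R) (a b : nat) (f g : N).
Local Notation X := (iota x).
Local Notation Y := (iota y).

(* The shape of (x, y^b): f |-> y^b g |-> 0 under x, and ker x = R g is free of rank one over
   the discrete valuation ring R / x, with uniformizer y. *)
Hypothesis N_gen : forall n, exists r s, n = r *: f + s *: g.
Hypothesis N_f : x *: f = y ^+ b *: g.
Hypothesis N_g : x *: g = 0.
Hypothesis N_ker : forall n, x *: n = 0 -> exists r, n = r *: g.
Hypothesis N_y : forall n : N, y *: n = 0 -> n = 0.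
Hypothesis N_ord : forall i j r, y ^+ i *: g = (r * y ^+ j) *: g -> (j <= i)%N.
Hypothesis N_dvr : forall r, r *: g = 0 \/
  exists i u u', r *: g = (u * y ^+ i) *: g /\ u' * u = 1.

Variables (l l' : nat).
Implicit Types (n : N) (q z k : Q) (r : R).
Hypothesis Q_im : kernel_sub Q (t ^+ l * X) (Y ^+ a) 0 X.
Hypothesis Q_ker : kernel_sub Q (t ^+ l' * Y ^+ a) X X 0.

Let N_yX i n : y ^+ i *: n = 0 -> n = 0.
Proof. by elim: i n => [|i IHi] n; rewrite ?scale1r // exprSr -scalerA => /IHi/N_y. Qed.
Let piYX i q : pi (Y ^+ i *: q) = y ^+ i *: pi q.
Proof. by rewrite -rmorphXn (spZ sp). Qed.
Let KtX i q : X *: (t ^+ i *: q) = 0 -> X *: q = 0.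
Proof. by rewrite scaleCA => E; apply: (sp_tXI sp (i := i)); rewrite E scaler0. Qed.

Let Y_reg i q z : Y ^+ a *: q = t ^+ i *: z -> exists q', q = t ^+ i *: q'.
Proof.
by apply: (fiberwise_reg (h := fun n => y ^+ a *: n) sp) => [q'|n /N_yX]; rewrite ?piYX.
Qed.

Let xQ q : exists2 k, X *: q = Y ^+ a *: k & X *: k = 0.
Proof.
have [|p Ep xp] := @Q_im q; first by rewrite scale0r.
have [k Ek] : exists k, p = t ^+ l *: k.
  by apply: (@Y_reg _ _ (X *: q)); rewrite -Ep scalerA.
exists k; last by apply: (@KtX l); rewrite -Ek.
by apply: (sp_tXI sp (i := l)); rewrite scalerA Ep Ek scaleCA.
Qed.

Let in_image i := `[< exists2 k, X *: k = 0 & pi k = y ^+ i *: g >].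

(** The length e is defined by K / tK = R y^e g, with kap in K a lift of y^e g. Modulo high powers of t,
    K is generated by kap and Q by lifts q0, qg of f, g. Write x q0 = y^a phi and
    x qg = y^a gam with phi = F kap, gam = G kap; then F = y^c modulo t, where c = b - a - e, and
    G = 0 modulo t. The equality c = e is proved by two inequalities. The element
    F qg - G q0 is killed by x and reduces to y^c g, whence e <= c. Conversely let
    kap = al q0 + be qg with be = y^e modulo t. Some t^n kap is u phi + v gam, and
    al F + be G = 0, so t^n be = F h with h = u be - v al. As F is a nonzerodivisor modulo t,
    t^n divides h, and F divides be modulo t. *)
Lemma parity_formula : exists e, b = (a + e.*2)%N.
Proof.
have [q0 Eq0] := sp_surj sp f; have [qg Eqg] := sp_surj sp g.
have [phi Ephi xphi] := xQ q0; have [gam Egam xgam] := xQ qg.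
have piphi : y ^+ a *: pi phi = y ^+ b *: g by rewrite -piYX -Ephi (spZ sp) Eq0.
have [gam1 Egam1] : exists gam1, gam = t *: gam1.
  apply/(sp_ker sp); apply: (@N_yX a).
  by rewrite -piYX -Egam (spZ sp) Eqg.
have xgam1 : X *: gam1 = 0 by apply: (@KtX 1); rewrite expr1 -Egam1.
have approxQ i q : exists u v z, q = u *: q0 + v *: qg + t ^+ i *: z.
  elim: i => [|i [u [v [z ->]]]]; first by exists 0, 0, q; rewrite !scale0r !add0r scale1r.
  have [r [s Ers]] := N_gen (pi z).
  have [z' ->] : exists z', z = (iota r *: q0 + iota s *: qg) + t *: z'.
    by apply: (sp_eq sp); rewrite (spD sp) !(spZ sp) Eq0 Eqg.
  exists (u + t ^+ i * iota r), (v + t ^+ i * iota s), z'.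
  rewrite !scalerDr !scalerDl !scalerA -exprSr -!addrA; congr (_ + _); exact: addrCA.
have ex_e : exists i, in_image i.
  exists b; apply/asboolP; exists (X *: q0); first by rewrite Ephi scaleCA xphi scaler0.
  by rewrite (spZ sp) Eq0.
have [e /asboolP[kap xkap Ekap] e_min] := ex_minnP ex_e.
have Kgen k : X *: k = 0 -> exists s k', k = iota s *: kap + t *: k' /\ X *: k' = 0.
  move=> xk; have [r Er] : exists r, pi k = r *: g by apply: N_ker; rewrite -(spZ sp) xk (sp0 sp).
  suff [s Es] : exists s, pi k = s *: pi kap.
    have [k' Ek'] : exists k', k = iota s *: kap + t *: k'.
      by apply: (sp_eq sp); rewrite (spZ sp).
    exists s, k'; split=> //; apply: (sp_tf sp).
    by move: xk; rewrite Ek' scalerDr scaleCA xkap scaler0 add0r scaleCA.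
  have [r0|[i [u [u' [Eru uu']]]]] := N_dvr r; first by exists 0; rewrite Er r0 scale0r.
  have le_ei : (e <= i)%N.
    apply: e_min; apply/asboolP; exists (iota u' *: k).
      by rewrite scaleCA xk scaler0.
    by rewrite (spZ sp) Er Eru scalerA mulrA uu' mul1r.
  by exists (u * y ^+ (i - e)); rewrite Er Eru Ekap scalerA -mulrA -exprD subnK.
have approxK i k : X *: k = 0 -> exists c k', k = c *: kap + t ^+ i *: k' /\ X *: k' = 0.
  move=> xk; elim: i => [|i [c [z [-> xz]]]]; first by exists 0, k; rewrite scale0r add0r scale1r.
  have [s [k' [-> xk']]] := Kgen z xz; exists (c + t ^+ i * iota s), k'; split=> //.
  by rewrite scalerDr scalerDl !scalerA -exprSr addrA.
have [s0 Es0] : exists s, pi phi = s *: pi kap.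
  by have [s [k' [-> _]]] := Kgen phi xphi; exists s; rewrite (spD sp) (spZ sp) (sp_t sp) addr0.
have le_b : (a + e <= b)%N.
  by apply: (N_ord (r := s0)); rewrite -piphi Es0 Ekap !scalerA exprD mulrCA mulrA.
pose c := (b - a - e)%N.
have piphiE : pi phi = y ^+ c *: pi kap.
  apply/eqP; rewrite -subr_eq0; apply/eqP/(@N_yX a); rewrite scalerBr piphi Ekap.
  by rewrite !scalerA -!exprD (_ : (a + (c + e))%N = b) ?subrr // /c; lia.
(* precision n + 1, since an equation is divided by t^n and then reduced modulo t *)
pose n := l'; pose i := n.+1.
have bound k : X *: k = 0 -> exists q, t ^+ n *: (Y ^+ a *: k) = X *: q.
  by move=> /Q_ker[q Eq _]; exists q; rewrite scalerA.
have [phi1 Ephi1] : exists z, phi = Y ^+ c *: kap + t *: z.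
  by apply: (sp_eq sp); rewrite piYX.
have xphi1 : X *: phi1 = 0.
  apply: (sp_tf sp); move: xphi; rewrite Ephi1 scalerDr scaleCA xkap scaler0 add0r.
  by rewrite scaleCA.
have [F1 [phi' [Ephi1' xphi']]] := approxK i _ xphi1.
have [G1 [gam' [Egam1' xgam']]] := approxK i _ xgam1.
pose F := Y ^+ c + t * F1; pose G := t * G1.
have EphiF : phi = F *: kap + t ^+ i *: (t *: phi').
  by rewrite Ephi1 Ephi1' /F scalerDr scalerDl scalerA addrA scaleCA.
have EgamG : gam = G *: kap + t ^+ i *: (t *: gam').
  by rewrite Egam1 Egam1' /G scalerDr scalerA scaleCA.
have modF : modeq t i phi (F *: kap) by exists (t *: phi').
have modG : modeq t i gam (G *: kap) by exists (t *: gam').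
have piF q : pi (F *: q) = y ^+ c *: pi q.
  by rewrite /F scalerDl -scalerA (spD sp) (sp_t sp) addr0 piYX.
have le_ec : (e <= c)%N.
  (* F gam - G phi vanishes only modulo a power of t, and the correction t q3 makes up for it *)
  pose k3 := F *: (t *: gam') - G *: (t *: phi').
  have xk3 : X *: k3 = 0.
    by rewrite /k3 scalerBr !(scaleCA X) xgam' xphi' !scaler0 subrr.
  have Ek3 : F *: gam - G *: phi = t ^+ i *: k3.
    have -> : F *: gam = (F * G) *: kap + t ^+ i *: (F *: (t *: gam')).
      by rewrite EgamG scalerDr scalerA (scaleCA F).
    have -> : G *: phi = (F * G) *: kap + t ^+ i *: (G *: (t *: phi')).
      by rewrite EphiF scalerDr scalerA mulrC (scaleCA G).
    by rewrite opprD addrACA subrr add0r /k3 scalerBr.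
  have [q3 Eq3] := bound _ xk3.
  apply: e_min; apply/asboolP; exists (F *: qg - G *: q0 - t *: q3); last first.
    by rewrite !(spB sp) piF /G -scalerA !(sp_t sp) !subr0 Eqg.
  rewrite !scalerBr !(scaleCA X) Egam Ephi -Eq3 !(scaleCA _ (Y ^+ a)) -!scalerBr Ek3.
  by rewrite scalerA -exprS subrr scaler0.
have le_ce : (c + e <= e + e)%N.
  have [q4 Eq4] := bound _ xkap; have [u [v [q5 Eq5]]] := approxQ i q4.
  have [k5 Ek5 _] := xQ q5.
  have kap_uv : modeq t i (t ^+ n *: kap) ((u * F + v * G) *: kap).
    have [k6 Ek6] : exists k6, t ^+ n *: kap - (u *: phi + v *: gam + t ^+ i *: k5) = t ^+ i *: k6.
      apply: (@Y_reg _ _ 0); rewrite scaler0 scalerBr !scalerDr !(scaleCA (Y ^+ a)).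
      by rewrite -Ephi -Egam -Ek5 Eq4 Eq5 !scalerDr !(scaleCA X) subrr.
    apply: (@modeq_trans _ _ _ _ _ (u *: phi + v *: gam)).
      by exists (k6 + k5); rewrite scalerDr -Ek6 addrCA subrK.
    rewrite scalerDl -(scalerA u) -(scalerA v).
    by apply: modeqD; apply: modeqZ; [exact: modF | exact: modG].
  have [q9 Eq9] : exists q9, kap = Y ^+ e *: qg + t *: q9.
    by apply: (sp_eq sp); rewrite piYX Eqg.
  have [al [be [q8 Eq8]]] := approxQ i q9.
  pose al1 := t * al; pose be1 := Y ^+ e + t * be.
  have kapE : kap = al1 *: q0 + be1 *: qg + t ^+ i *: (t *: q8).
    rewrite {1}Eq9 Eq8 !scalerDr (scaleCA t (t ^+ i)) addrA; congr (_ + _).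
    by rewrite /al1 /be1 scalerDl -!scalerA addrCA.
  have pibe q : pi (be1 *: q) = y ^+ e *: pi q.
    by rewrite /be1 scalerDl -scalerA (spD sp) (sp_t sp) addr0 piYX.
  have [k8 Ek8 _] := xQ (t *: q8).
  have rel : modeq t i ((al1 * F + be1 * G) *: kap) 0.
    have [k9 Ek9] : exists k9, al1 *: phi + be1 *: gam + t ^+ i *: k8 = t ^+ i *: k9.
      apply: (@Y_reg _ _ 0); rewrite scaler0 !scalerDr !(scaleCA (Y ^+ a)).
      by rewrite -Ephi -Egam -Ek8 !(scaleCA _ X) -!scalerDr -kapE.
    apply: (@modeq_trans _ _ _ _ _ (al1 *: phi + be1 *: gam)).
      rewrite scalerDl -(scalerA al1) -(scalerA be1).
      by apply: modeqD; apply: modeqZ; apply: modeq_sym; [exact: modF | exact: modG].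
    exists (k9 - k8); rewrite add0r scalerBr -Ek9 addrK //.
  pose h := u * be1 - v * al1.
  have [z Ez] : modeq t i (t ^+ n *: (be1 *: kap)) (F *: (h *: kap)).
    rewrite scaleCA; apply: (modeq_trans (modeqZ _ kap_uv)).
    have -> : be1 *: ((u * F + v * G) *: kap) = F *: (h *: kap) + v *: ((al1 * F + be1 * G) *: kap).
      rewrite !scalerA -scalerDl; congr (_ *: _); rewrite /h; ring.
    rewrite -[X in modeq _ _ _ X]addr0; apply: modeqD; first exact: modeq_refl.
    by rewrite -(scaler0 _ v); exact: modeqZ.
  have EF : F *: (h *: kap) = t ^+ n *: (be1 *: kap - t *: z).
    by rewrite scalerBr Ez [t ^+ n *: (t *: z)]scalerA -exprSr addrK.
  have [k12 Ek12] : exists k12, h *: kap = t ^+ n *: k12.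
    by apply: (fiberwise_reg (h := fun n => y ^+ c *: n) sp piF _ EF) => n0; exact: N_yX.
  have xk12 : X *: k12 = 0 by apply: (@KtX n); rewrite -Ek12 scaleCA xkap scaler0.
  have [s [k' [Ek' _]]] := Kgen _ xk12.
  have : F *: k12 = be1 *: kap - t *: z by apply: (sp_tXI sp (i := n)); rewrite -EF Ek12 scaleCA.
  move=> /(congr1 pi); rewrite piF (spB sp) (sp_t sp) subr0 pibe Ekap Ek'.
  rewrite (spD sp) (spZ sp) (sp_t sp) addr0 Ekap !scalerA => Es.
  by apply: (N_ord (r := s)); rewrite exprD -Es exprD mulrCA mulrA.
exists e; move: le_b le_ec le_ce; rewrite /c; lia.
Qed.
End Parity.

Section DoubleLine.
Variables (k : fieldType) (R : comAlgType k) (pi : {rmorphism powser 2 k -> R}).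
Local Notation X := (pvar k (0 : 'I_2)).
Local Notation Y := (pvar k (1 : 'I_2)).
Hypothesis pi_surj : forall r, exists p, r = pi p.
Hypothesis pi_ker : forall p, pi p = 0 <-> exists c, p = c * X ^+ 2.
Local Notation x := (pi X).
Local Notation y := (pi Y).
Implicit Types r : R.

Lemma double_line_eq p q : pi p = pi q -> exists c, p = q + c * X ^+ 2.
Proof.
move=> E; have /pi_ker[c Ec] : pi (p - q) = 0 by rewrite rmorphB E subrr.
by exists c; rewrite -Ec addrC subrK.
Qed.

Lemma double_line_xx : x * x = 0.
Proof.
by rewrite -rmorphM; apply/pi_ker; exists 1; rewrite mul1r expr2.
Qed.

Lemma double_line_ker_x r : x * r = 0 -> exists s, r = s * x.
Proof.
have [p ->] := pi_surj r; rewrite -rmorphM => /pi_ker[c E]; exists (pi c).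
rewrite -rmorphM; congr (pi _); apply: (@pvarX_inj _ _ 0 1).
by rewrite expr1 E; ring.
Qed.

Lemma double_line_y_reg r : y * r = 0 -> r = 0.
Proof.
have [p ->] := pi_surj r; rewrite -rmorphM => /pi_ker[c E].
apply/pi_ker; suff [g ->] : exists g, p = X ^+ 2 * g by exists g; rewrite mulrC.
apply: pvarX_dvd => m m0; have := pcoef_pvarM (1 : 'I_2) p (m + U_(1))%MM.
rewrite mnmDE mnm1E eqxx addn1 ltn0Sn addmK => <-.
by rewrite E mulrC pcoef_pvarXM mnmDE mnm1E addn0 leqNgt m0.
Qed.

Lemma double_line_ord i j r : y ^+ i * x = r * y ^+ j * x -> (j <= i)%N.
Proof.
have [p ->] := pi_surj r; rewrite -!rmorphXn -!rmorphM => /double_line_eq[c E].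
rewrite leqNgt; apply/negP => lt_ij.
have {}E : Y ^+ i = Y ^+ j * p + X * c.
  by apply: (@pvarX_inj _ _ 0 1); rewrite expr1 mulrC E; ring.
pose m := (U_(1) *+ i)%MM : 'X_{1..2}.
have mE l : m l = if 1 == l then i else 0%N.
  by rewrite /m mulmnE mnm1E; case: eqP; rewrite ?mul1n ?mul0n.
have mm0 : (m - U_(1) *+ i)%MM = 0%MM by apply/mnmP => l; rewrite mnmBE mnm0E subnn.
have := pcoef_pvarXM (1 : 'I_2) i (1 : powser 2 k) m.
rewrite mulr1 E mE eqxx leqnn mm0 pcoef1 eqxx pcoefD pcoef_pvarXM mE eqxx leqNgt lt_ij.
by rewrite pcoef_pvarM mE addr0 => /eqP; rewrite eq_sym oner_eq0.
Qed.

(** R / x is k[[y]]: r x depends only on the terms of r without x, which form a power of y times a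
    unit. *)
Lemma double_line_dvr r : r * x = 0 \/
  exists i u u', r * x = u * y ^+ i * x /\ u' * u = 1.
Proof.
have [p ->] := pi_surj r.
pose p1 := PowSer (fun m : 'X_{1..2} => if m 0 == 0%N then pcoef p m else 0).
have p1x : pi p * x = pi p1 * x.
  have [g Eg] : exists g, p - p1 = X ^+ 1 * g.
    apply: pvarX_dvd => m; rewrite ltnS leqn0 pcoefD pcoefN /= => ->.
    exact: subrr.
  apply/eqP; rewrite -subr_eq0 -mulrBl -rmorphB Eg rmorphM rmorphXn expr1 mulrAC.
  by rewrite double_line_xx mul0r.
rewrite p1x.
have [p0|] := pselect (forall m, pcoef p1 m = 0).
  left; suff -> : p1 = 0 by rewrite rmorph0 mul0r.
  exact: powserP.
move=> /existsNP[m0 /eqP p1m0]; right.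
have ex_i : exists i, `[< exists m : 'X_{1..2}, m 1 = i /\ pcoef p1 m != 0 >].
  by exists (m0 1); apply/asboolP; exists m0.
have [i /asboolP[m [mi p1m]] i_min] := ex_minnP ex_i.
have [u Eu] : exists u, p1 = Y ^+ i * u.
  apply: pvarX_dvd => m' lt_m'; apply: contrapT => /eqP p1m'.
  have := i_min (m' 1); rewrite leqNgt lt_m' => h.
  by suff: false by []; apply: h; apply/asboolP; exists m'.
have [|u' uu'] := @powser_unit _ _ u.
  have mX : (m - U_(1) *+ i)%MM = 0%MM.
    have m_0 : m 0 = 0%N by move: p1m; rewrite /p1 /=; case: (m 0 =P 0%N) => // _; rewrite eqxx.
    apply/mnmP => l; rewrite mnmBE mulmnE mnm1E mnm0E.
    have [<-|ne] := eqVneq 1 l; first by rewrite mi mul1n subnn.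
    suff -> : l = 0 by rewrite m_0.
    by apply/val_inj; case: l ne => [[|[|l]] lt_l] // /eqP[]; apply/val_inj.
  by move: p1m; rewrite Eu pcoef_pvarXM mi leqnn mX.
exists i, (pi u), (pi u'); split; last by rewrite -rmorphM mulrC uu' rmorph1.
by rewrite Eu rmorphM rmorphXn [pi u * _]mulrC.
Qed.

Lemma degenerates_parity a b :
  degenerates (ideal [:: x; y ^+ a]) (ideal [:: x; y ^+ b]) ->
  exists e, b = (a + e.*2)%N.
Proof.
move=> deg; have [T [iota [t [Q [sp [h tr]]]]]] :=
  degenerates_specialization (ideal2_fin_gen _ _) deg.
have [|l hl] := tr x (y ^+ a) 0 x.
  apply/kernel_sub_ideal => m [c [d ->]] _; exists (d * x); split.
  - by exists d, 0; ring.
  - by rewrite mulrDr mulrCA double_line_xx mulr0 add0r; ring.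
  - by rewrite mulrCA double_line_xx mulr0.
have [|l' hl'] := tr (y ^+ a) x x 0.
  apply/kernel_sub_ideal => m _ /double_line_ker_x[s ->]; exists (s * y ^+ a); split.
  - by exists 0, s; rewrite mul0r add0r.
  - by ring.
  - exact: mul0r.
rewrite rmorph0 rmorphXn in hl; rewrite rmorph0 rmorphXn in hl'.
apply: (@parity_formula _ _ _ _ _ _ _ h _ _ a b (ideal2_snd _ _) (ideal2_fst _ _) _ _ _ _ _ _ _ l l' hl hl').
- by move=> n; have [c [d ->]] := ideal2_gen n; exists d, c; rewrite addrC.
- by apply: ideal_val_inj; exact: mulrC.
- by apply: ideal_val_inj; exact: double_line_xx.
- move=> n /(congr1 (@ideal_val _ _))/double_line_ker_x[s Es]; exists s.
  exact: ideal_val_inj.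
- by move=> n /(congr1 (@ideal_val _ _))/double_line_y_reg E; apply: ideal_val_inj.
- by move=> i j r /(congr1 (@ideal_val _ _))/double_line_ord.
move=> r; have [r0|[i [u [u' [E uu']]]]] := double_line_dvr r; [left|right].
  exact: ideal_val_inj.
by exists i, u, u'; split=> //; apply: ideal_val_inj.
Qed.
End DoubleLine.

(** * The discrete valuation ring k[[t]] *)

Section PowerSeriesDVR.
Variable k : fieldType.
Local Notation V := (powser 1 k).
Local Notation t := (pvar k (0 : 'I_1)).

Lemma mnm1_0 (m : 'X_{1..1}) : m 0 = 0%N -> m = 0%MM.
Proof. by move=> m0; apply/mnmP => i; rewrite ord1 m0 mnm0E. Qed.

Lemma powser1_factor (f : V) : f != 0 -> exists i u u', f = t ^+ i * u /\ u * u' = 1.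
Proof.
move=> f0; have ex_i : exists i, `[< exists m : 'X_{1..1}, m 0 = i /\ pcoef f m != 0 >].
  apply: contrapT => h; case/eqP: f0; apply: powserP => m; apply: contrapT => /eqP fm.
  by apply: h; exists (m 0); apply/asboolP; exists m.
have [i /asboolP[m [mi fm]] i_min] := ex_minnP ex_i.
have [u Eu] : exists u, f = t ^+ i * u.
  apply: pvarX_dvd => m' lt_m'; apply: contrapT => /eqP fm'.
  have := i_min (m' 0); rewrite leqNgt lt_m' => h.
  by suff: false by []; apply: h; apply/asboolP; exists m'.
have [|u' uu'] := @powser_unit _ _ u; last by exists i, u, u'.
have mX : (m - U_(0%R) *+ i)%MM = 0%MM.
  by apply: mnm1_0; rewrite mnmBE mulmnE mnm1E eqxx mul1n mi subnn.
by move: fm; rewrite Eu pcoef_pvarXM mi leqnn mX.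
Qed.

Lemma powser1_unit_or (f : V) : principal t f \/ exists f', f * f' = 1.
Proof.
have [f0|f0] := eqVneq (pcoef f 0%MM) 0; [left|right; exact: powser_unit].
have [g ->] : exists g, f = t ^+ 1 * g.
  by apply: pvarX_dvd => m; rewrite ltnS leqn0 => /eqP/mnm1_0 ->.
by exists g; rewrite mulrC.
Qed.

Lemma powser1_domain : GRing.integral_domain_axiom V.
Proof.
move=> f g fg0; apply: contrapT => /negP; rewrite negb_or => /andP[f0 g0].
have [i [u [u' [Ef uu']]]] := powser1_factor f0.
have [j [v [v' [Eg vv']]]] := powser1_factor g0.
have E : t ^+ (i + j) * 1 = t ^+ (i + j) * 0.
  transitivity (f * g * (u' * v')); last by rewrite fg0 mul0r mulr0.
  transitivity (t ^+ (i + j) * ((u * u') * (v * v'))); first by rewrite uu' vv' !mulr1.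
  by rewrite Ef Eg exprD; ring.
by have /eqP := pvarX_inj E; rewrite oner_eq0.
Qed.

Lemma powser1_pid (I : V -> Prop) : is_ideal I -> exists a, forall f, I f <-> principal a f.
Proof.
move=> [I0 _ IZ]; have [If0|/existsNP[f0 /not_implyP[If0 nf0]]] :=
  pselect (forall f, I f -> f = 0).
  exists 0 => f; split=> [/If0 ->|[c ->]]; last by rewrite mulr0.
  by exists 0; rewrite mul0r.
have It f : I f -> f != 0 -> exists i u, I (t ^+ i) /\ f = t ^+ i * u.
  move=> If /powser1_factor[i [u [u' [E uu']]]]; exists i, u; split=> //.
  by have := IZ u' f If; rewrite E mulrCA [u' * u]mulrC uu' mulr1.
have ex_i : exists i, `[< I (t ^+ i) >].
  have [|i [_ [Ii _]]] := It f0 If0; first exact/eqP.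
  by exists i; apply/asboolP.
have [i /asboolP Ii i_min] := ex_minnP ex_i.
exists (t ^+ i) => f; split=> [If|[c ->]]; last exact: IZ.
have [->|f_neq0] := eqVneq f 0; first by exists 0; rewrite mul0r.
have [j [u [Ij ->]]] := It f If f_neq0.
have le_ij : (i <= j)%N by apply: i_min; apply/asboolP.
by exists (t ^+ (j - i) * u); rewrite mulrAC -exprD subnK.
Qed.

Lemma powser1_not1 : ~ principal t 1.
Proof.
move=> [c /(congr1 (fun f : V => pcoef f 0%MM))].
rewrite pcoef1 eqxx mulrC pcoef_pvarM mnm0E /=.
by move/eqP; rewrite oner_eq0.
Qed.

Lemma powser1_is_dvr : is_dvr t.
Proof.
have t_ideal : is_ideal (principal t).
  split; first by exists 0; rewrite mul0r.
    by move=> _ _ [c ->] [d ->]; exists (c + d); rewrite mulrDl.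
  by move=> a _ [c ->]; exists (a * c); rewrite mulrA.
have proper_sub J : is_ideal J -> ~ J 1 -> forall f, J f -> principal t f.
  move=> [_ _ JZ] J1 f Jf; have [//|[f' E]] := powser1_unit_or f.
  by case: J1; rewrite -E mulrC; exact: JZ.
split.
- exact: powser1_domain.
- exact: powser1_pid.
- split=> //; first exact: powser1_not1.
  by move=> J J_ideal _ J1; exact: proper_sub.
- move=> I [I_ideal I1 I_max] f; split; first exact: proper_sub.
  by apply: I_max => //; [exact: proper_sub | exact: powser1_not1].
- apply/eqP => E; apply: powser1_not1.
  have : t ^+ 1 * 1 = t ^+ 1 * 0 by rewrite expr1 E !mul0r.
  by move/pvarX_inj ->; exists 0; rewrite mul0r.
Qed.

Lemma powser1_residue :
  bijective (fun c : k => mod_pi t (M := V^o) (c%:A : V)).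
Proof.
have cA (c : k) : pcoef (c%:A : V) 0%MM = c by rewrite pcoefZ pcoef1 eqxx mulr1.
have t0 (f : V) : pcoef (t * f) 0%MM = 0 by rewrite pcoef_pvarM mnm0E.
exists (fun f => pcoef (repr f : V) 0%MM).
  move=> c; have /mod_pi_eq[g E] : mod_pi t (M := V^o) (repr (mod_pi t (M := V^o) (c%:A : V))) = mod_pi t (M := V^o) (c%:A : V).
    exact: reprK.
  have := congr1 (fun f : V => pcoef f 0%MM) E.
  by rewrite [RHS]t0 pcoefD pcoefN cA => /eqP; rewrite subr_eq0 => /eqP.
move=> q; transitivity (mod_pi t (M := V^o) (repr q)); last exact: reprK.
apply: (proj2 (@mod_pi_eq _ t V^o _ _)); set f := repr q.
have [g E] : exists g, (pcoef (f : V) 0%MM)%:A - (f : V) = t ^+ 1 * g.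
  apply: pvarX_dvd => m; rewrite ltnS leqn0 => /eqP/mnm1_0 ->.
  by rewrite pcoefD pcoefN cA subrr.
by exists g.
Qed.

Lemma powser1_div_total (u v : V) : (exists c, v = c * u) \/ (exists c, u = c * v).
Proof.
have [->|u0] := eqVneq u 0; first by right; exists 0; rewrite mul0r.
have [->|v0] := eqVneq v 0; first by left; exists 0; rewrite mul0r.
have [i [u1 [u1' [-> uu]]]] := powser1_factor u0.
have [j [v1 [v1' [-> vv]]]] := powser1_factor v0.
case/orP: (leq_total i j) => le_ij; [left|right].
  exists (t ^+ (j - i) * v1 * u1'); rewrite -[LHS]mulr1 -uu -{1}(subnK le_ij) exprD; ring.
exists (t ^+ (i - j) * u1 * v1'); rewrite -[LHS]mulr1 -vv -{1}(subnK le_ij) exprD; ring.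
Qed.

Definition powser1_dvr : dvr k := Dvr powser1_is_dvr powser1_residue.
End PowerSeriesDVR.

(** * Torsion-free modules over a valuation ring are flat *)

Section LocalTensor.
Variables (A : comPzRingType) (M Y : lmodType A).

Definition submodule (P : M -> Prop) : Prop :=
  [/\ P 0, forall m m', P m -> P m' -> P (m + m') & forall a m, P m -> P (a *: m)].
Definition linear_on (P : M -> Prop) (mu : M -> A) : Prop :=
  (forall m m', P m -> P m' -> mu (m + m') = mu m + mu m') /\
  (forall a m, P m -> mu (a *: m) = a * mu m).

(** An equality of tensors involves only finitely many elements of M, so it can be tested
    with functionals defined on a submodule that contains these. *)
Lemma tens_eq_local (s s' : seq (M * Y)) : tens_eq s s' ->
  exists L : seq M, forall P mu, submodule P -> linear_on P mu ->
    (forall m, m \in L -> P m) ->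
    \sum_(p <- s) mu p.1 *: p.2 = \sum_(p <- s') mu p.1 *: p.2.
Proof.
elim=> {s s'}.
- by move=> s; exists [::].
- by move=> s s' _ [L h]; exists L => P mu subP lin_mu LP; rewrite (h P).
- move=> s1 s2 s3 _ [L h] _ [L' h']; exists (L ++ L') => P mu subP lin_mu LP.
  rewrite (h P) ?(h' P) // => m mL; apply: LP; rewrite mem_cat mL ?orbT //.
- move=> s1 s1' s2 s2' _ [L h] _ [L' h']; exists (L ++ L') => P mu subP lin_mu LP.
  rewrite !big_cat /= (h P) ?(h' P) // => m mL; apply: LP; rewrite mem_cat mL ?orbT //.
- by move=> s1 s2; exists [::] => P mu _ _ _; rewrite !big_cat /= addrC.
- move=> y; exists [::] => P mu [P0 _ _] [_ muZ] _.
  by rewrite big_seq1 big_nil -[X in mu X](scale0r 0) muZ // mul0r scale0r.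
- move=> m m' y; exists [:: m; m'] => P mu _ [muD _] LP.
  rewrite big_seq1 big_cons big_seq1 /= muD ?scalerDl //; apply: LP; rewrite !inE eqxx ?orbT //.
- by move=> m y y'; exists [::] => P mu _ _ _; rewrite big_seq1 big_cons big_seq1 /= scalerDr.
move=> a m y; exists [:: m] => P mu _ [_ muZ] LP.
by rewrite !big_seq1 /= muZ ?scalerA 1?mulrC //; apply: LP; rewrite inE.
Qed.
End LocalTensor.

Section ValuationRing.
Variable A : comNzRingType.
Hypothesis div_total : forall u v : A, (exists c, v = c * u) \/ (exists c, u = c * v).
Variable M : lmodType A.
Hypothesis M_tf : forall (a : A) (m : M), a *: m = 0 -> a = 0 \/ m = 0.

(** Divisibility is total, so finitely many elements have a common divisor among them. *)
Lemma common_divisor (I : finType) (c : I -> A) (D : {set I}) i0 : i0 \in D ->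
  exists2 j, j \in D & forall i, i \in D -> exists d, c i = d * c j.
Proof.
move=> i0D; suff [j jD h] : exists2 j, j \in D & forall i, i \in enum D -> exists d, c i = d * c j.
  by exists j => // i iD; apply: h; rewrite mem_enum.
have : {subset enum D <= D} by move=> i; rewrite mem_enum.
elim: (enum D) => [|i s IHs] sD; first by exists i0.
have [|j jD h] := IHs; first by move=> i' i's; apply: sD; rewrite inE i's orbT.
have [[d E]|[d E]] := div_total (c j) (c i).
  by exists j => // i'; rewrite inE => /orP[/eqP->|/h //]; exists d.
exists i; first by apply: sD; rewrite mem_head.
move=> i'; rewrite inE => /orP[/eqP->|/h[d' ->]]; first by exists 1; rewrite mul1r.
by exists (d' * d); rewrite E mulrA.
Qed.

Section Basis.
Variables (n : nat) (e : 'I_n -> M).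

Definition spanned (D : {set 'I_n}) (m : M) : Prop :=
  exists c : 'I_n -> A, m = \sum_(i in D) c i *: e i.

Lemma spanned_submodule D : submodule (spanned D).
Proof.
split; first by exists (fun=> 0); rewrite big1 // => i _; rewrite scale0r.
  move=> _ _ [c ->] [d ->]; exists (fun i => c i + d i).
  by rewrite -big_split; apply: eq_bigr => i _; rewrite scalerDl.
move=> a _ [c ->]; exists (fun i => a * c i).
by rewrite scaler_sumr; apply: eq_bigr => i _; rewrite scalerA.
Qed.

Lemma spanned_sum D (J : {set 'I_n}) (c : 'I_n -> A) :
  (forall i, i \in J -> spanned D (e i)) -> spanned D (\sum_(i in J) c i *: e i).
Proof.
have [P0 PD PZ] := spanned_submodule D.
by move=> h; apply: big_ind => // i iJ; apply: PZ; exact: h.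
Qed.

(** A minimal generating subfamily is independent: in a relation among its members, some
    coefficient divides all others, and after division the corresponding member is redundant. *)
Lemma exists_basis : exists D : {set 'I_n}, (forall i, spanned D (e i)) /\
  forall c : 'I_n -> A, \sum_(i in D) c i *: e i = 0 -> forall i, i \in D -> c i = 0.
Proof.
have ex_d : exists d, `[< exists D : {set 'I_n}, #|D| = d /\ forall i, spanned D (e i) >].
  exists #|[set: 'I_n]|; apply/asboolP; exists setT; split=> // i.
  exists (fun j => (j == i)%:R); rewrite (bigD1 i) ?inE //= eqxx scale1r.
  by rewrite big1 ?addr0 // => j /andP[_ /negPf ->]; rewrite scale0r.
have [d /asboolP[D [cardD spanD]] d_min] := ex_minnP ex_d.
exists D; split=> // c c0 i iD; apply: contrapT => ci0.
have [j jD h] := common_divisor c iD.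
have cj0 : c j <> 0 by move=> E; have [a Ea] := h i iD; apply: ci0; rewrite Ea E mulr0.
have /choice[a Ha] : forall l, exists a, l \in D -> c l = a * c j.
  move=> l; case lD: (l \in D); last by exists 0.
  by have [a Ea] := h l lD; exists a.
have rel : \sum_(l in D :\ j) a l *: e l = - e j.
  have : c j *: (\sum_(l in D) a l *: e l - (a j - 1) *: e j) = 0.
    rewrite scalerBr scaler_sumr scalerA mulrBr mulr1 [c j * a j]mulrC -Ha // subrr scale0r subr0.
    by rewrite -[RHS]c0; apply: eq_bigr => l lD; rewrite scalerA mulrC -Ha.
  case/M_tf => // E; apply/eqP; rewrite -addr_eq0; apply/eqP; rewrite -[RHS]E.
  rewrite [in RHS](big_setD1 j jD) /= scalerBl scale1r opprB.
  by rewrite [X in _ = X + _]addrC -addrA; congr (_ + _); rewrite addrC subrK.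
have ej : spanned (D :\ j) (e j).
  have [_ _ PZ] := spanned_submodule (D :\ j).
  by rewrite -[e j]opprK -rel -scaleN1r; apply: PZ; exists a.
have : (d <= #|D :\ j|)%N.
  apply: d_min; apply/asboolP; exists (D :\ j); split=> // l.
  have [b ->] := spanD l; apply: spanned_sum => l' l'D.
  have [->//|ne] := eqVneq l' j.
  exists (fun m => (m == l')%:R); rewrite (bigD1 l') ?inE ?ne //= eqxx scale1r.
  by rewrite big1 ?addr0 // => m /andP[_ /negPf ->]; rewrite scale0r.
by rewrite -cardD (cardsD1 j D) jD ltnn.
Qed.
End Basis.

(** If sum m_i (x) f x_i vanishes in M (x) Y, this is witnessed by finitely many elements of M.
    Together with the m_i they generate a submodule with a basis, and the coordinates of the m_i
    give relations among the f x_i, hence among the x_i. *)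
Lemma torsion_free_flat : flat M.
Proof.
move=> X Y f f_inj.
have balf : balanced (fun (m : M) x => pure m (f x)).
  split=> [m m' x|m x x'|a m x]; first exact: pureDl.
    by rewrite raddfD pureDr.
  by rewrite pureZ linearZ.
suff ker0 w : tens_map (M := M) f w = 0 -> w = 0.
  move=> w w' E; apply/eqP; rewrite -subr_eq0; apply/eqP/ker0.
  apply: (addIr (tens_map f w')); rewrite -(tens_liftD balf) subrK add0r; exact: E.
rewrite -(tens_reprK w); move: (tens_repr w) => s {w}.
rewrite /tens_map (tens_lift_cls balf) => E.
have /tens_clsP/tens_eq_local[L HL] : tens_cls [seq (p.1, f p.2) | p <- s] = tens_cls [::].
  by rewrite tens_cls_sum big_map E.
pose L' := L ++ [seq p.1 | p <- s]; pose e (i : 'I_(size L')) := L'`_i.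
have [D [spanD indep]] := exists_basis e.
have inP m : m \in L' -> spanned e D m.
  by move=> mL; have := spanD (Ordinal (etrans (index_mem m L') mL)); rewrite /e /= nth_index.
have /choice[c Hc] : forall m, exists c, spanned e D m -> m = \sum_(i in D) c i *: e i.
  move=> m; have [[c Ec]|h] := pselect (spanned e D m); first by exists c.
  by exists (fun=> 0) => /h.
have [P0 PD PZ] := spanned_submodule e D.
have uniq_c m d i : i \in D -> m = \sum_(i in D) d i *: e i -> c m i = d i.
  move=> iD Em; apply/eqP; rewrite -subr_eq0; apply/eqP.
  apply: (indep (fun i => c m i - d i)) => //.
  rewrite (eq_bigr (fun i => c m i *: e i - d i *: e i)) => [|j _]; last by rewrite scalerBl.
  by rewrite sumrB -Em -Hc ?subrr //; exists d.
have lin_c i : i \in D -> linear_on (spanned e D) (fun m => c m i).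
  move=> iD; split=> [m m' Pm Pm'|a m Pm]; apply: (uniq_c _ (fun i => _)) => //.
    rewrite {1}(Hc m Pm) {1}(Hc m' Pm') -big_split.
    by apply: eq_bigr => j _; rewrite scalerDl.
  by rewrite {1}(Hc m Pm) scaler_sumr; apply: eq_bigr => j _; rewrite scalerA.
rewrite tens_cls_sum.
have -> : \sum_(p <- s) pure p.1 p.2 =
    \sum_(i in D) \sum_(p <- s) pure (e i) (c p.1 i *: p.2).
  rewrite exchange_big /= big_seq [RHS]big_seq; apply: eq_bigr => p ps.
  rewrite {1}[p.1]Hc; last by apply: inP; rewrite mem_cat map_f ?orbT.
  rewrite pure_suml.
  by apply: eq_bigr => i _; rewrite pureZ.
apply: big1 => i iD.
rewrite -pure_sumr; suff -> : \sum_(p <- s) c p.1 i *: p.2 = 0 by exact: pure0r.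
apply: f_inj; rewrite raddf0 raddf_sum.
have LP m : m \in L -> spanned e D m by move=> mL; apply: inP; rewrite mem_cat mL.
have := HL _ _ (spanned_submodule e D) (lin_c i iD) LP.
rewrite big_map big_nil => E0; rewrite -[RHS]E0.
by apply: eq_bigr => p _ /=; exact: linearZ.
Qed.
End ValuationRing.

(** * Lattices in M (x) V_t *)

Lemma lmod_iso_sym (A : pzRingType) (M N : lmodType A) : lmod_iso M N -> lmod_iso N M.
Proof.
move=> [f [g fK gK]].
have g_lin : linear g by move=> a u v; apply: (can_inj fK); rewrite linearP !gK.
pose F := GRing.isLinear.Build _ _ _ _ g g_lin.
pose gL : {linear N -> M} := HB.pack g F.
by exists gL; exists f.
Qed.

Lemma lmod_iso_of (A : pzRingType) (M N : lmodType A) (f : M -> N) :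
  linear f -> (forall m, f m = 0 -> m = 0) -> (forall n, exists m, f m = n) -> lmod_iso M N.
Proof.
move=> f_lin f_ker /choice[g gK].
pose F := GRing.isLinear.Build _ _ _ _ f f_lin.
pose fL : {linear M -> N} := HB.pack f F.
exists fL; exists g => //; move=> m; apply/eqP; rewrite -subr_eq0; apply/eqP/f_ker.
by rewrite -[f _]/(fL _) linearB /= gK subrr.
Qed.

Section BaseChange.
Variables (k : fieldType) (R : comAlgType k) (V : dvr k).
Local Notation t := (dvr_unif V).
Local Notation Vt := (dvr_loc V).
Local Notation tau := (inr_alg R t).

Lemma dvr_frac_shift i j : dvr_frac (t ^+ i) (i + j) = dvr_frac 1 j :> Vt.
Proof. by rewrite -[RHS](frac_shift t i); congr (frac _ _ _); exact: esym (mulr1 _). Qed.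
Lemma dvr_fracX i : dvr_frac (t ^+ i) i = 1 :> Vt.
Proof. by rewrite -{2}[i]addn0 dvr_frac_shift. Qed.

(** The canonical map R (x) V -> R (x) V_t. *)
Definition to_loc (A : tensA R V) : tensA R Vt :=
  tens_lift (fun r v => pureA r (dvr_frac v 0)) A.

Fact to_loc_bal : balanced (fun (r : R) (v : V) => pureA r (dvr_frac v 0)).
Proof.
split=> [r r' v|r v v'|c r v]; rewrite ?frac0D ?frac0Z; first exact: pureDl.
  exact: pureDr.
exact: pureZ.
Qed.
Lemma to_loc_pure r (v : V) : to_loc (pureA r v) = pureA r (dvr_frac v 0).
Proof. exact: (tens_lift_pure to_loc_bal). Qed.
Fact to_locD A B : to_loc (A + B) = to_loc A + to_loc B.
Proof. exact: (tens_liftD to_loc_bal). Qed.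
Fact to_loc_zmod : zmod_morphism to_loc.
Proof. by move=> A B; apply: (addIr (to_loc B)); rewrite -to_locD !subrK. Qed.
Lemma tensA_ind (S : comAlgType k) (P : tensA R S -> Prop) :
  (forall A B, P A -> P B -> P (A + B)) -> (forall r v, P (pureA r v)) -> forall A, P A.
Proof.
move=> PD Pp A; have P0 : P 0 by rewrite -(pure0l R (0 : S)); exact: Pp.
exact: (@tens_ind k R S).
Qed.
Fact to_loc_monoid : monoid_morphism to_loc.
Proof.
split; first exact: to_loc_pure.
elim/tensA_ind => [A A' IH IH' B|r v]; first by rewrite mulrDl !to_locD IH IH' mulrDl.
elim/tensA_ind => [B B' IH IH'|r' v']; first by rewrite mulrDr !to_locD IH IH' mulrDr.
by rewrite pureAM !to_loc_pure pureAM dvr_fracM.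
Qed.
HB.instance Definition _ := GRing.isZmodMorphism.Build _ _ to_loc to_loc_zmod.
HB.instance Definition _ := GRing.isMonoidMorphism.Build _ _ to_loc to_loc_monoid.

Lemma tensA_expand (A : tensA R V) : exists r B, A = inl_alg V r + tau * B.
Proof.
elim/tensA_ind: A => [A A' [r [B ->]] [r' [B' ->]]|r v].
  by exists (r + r'), (B + B'); rewrite rmorphD mulrDr addrACA.
exists (r * (dhead v)%:A), (pureA r (dtail v)); rewrite pureAM mul1r {1}[v]dheadE.
rewrite [LHS]pureDr; congr (_ + _).
by rewrite mulr_algr; exact: (esym (@pureZ k R V _ _ _)).
Qed.

Lemma to_loc_inl r : to_loc (inl_alg V r) = pureA r 1.
Proof. exact: to_loc_pure. Qed.
Lemma to_loc_tauX i : to_loc (tau ^+ i) = pureA 1 (dvr_frac (t ^+ i) 0).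
Proof. by rewrite inr_algX to_loc_pure. Qed.

Variable M : lmodType R.
Local Notation W := (tensM M Vt^o).
Local Notation pureM := (@pureM k R Vt M Vt^o).

Lemma scale_inl_pureM r m x : to_loc (inl_alg V r) *: pureM m x = pureM (r *: m) x.
Proof. by rewrite to_loc_inl tensM_scale scale1r. Qed.
Lemma scale_tauX_pureM i m v j :
  to_loc (tau ^+ i) *: pureM m (dvr_frac v j) = pureM m (dvr_frac (t ^+ i * v) j).
Proof. by rewrite to_loc_tauX tensM_scale scale1r -[_ *: _]/(_ * _) dvr_fracM. Qed.

Lemma scale_tauX_pureMX i m j :
  to_loc (tau ^+ i) *: pureM m (dvr_frac (t ^+ j) 0) = pureM m (dvr_frac (t ^+ (i + j)) 0).
Proof. by rewrite scale_tauX_pureM exprD. Qed.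

Lemma slice_pureX n m i :
  slice n (pureM m (dvr_frac (t ^+ i) 0)) = if n == i then m else 0.
Proof.
rewrite slice_pure lcoef_frac addn0 dcoefX; case: eqP => _.
  by rewrite !scale1r.
by rewrite !scale0r.
Qed.

Lemma sliceB n (w w' : W) : slice n (w - w') = slice n w - slice n w'.
Proof. by apply: (addIr (slice n w')); rewrite -sliceD !subrK. Qed.

Lemma slice_tau n (w : W) : slice n.+1 (to_loc tau *: w) = slice n w.
Proof.
rewrite to_loc_pure; elim/tensM_ind: w => [|w w' IH IH'|m x].
- by rewrite scaler0 !slice0.
- by rewrite scalerDr !sliceD IH IH'.
elim/loc_ind: x => v j; rewrite tensM_scale scale1r !slice_pure.
rewrite -[dvr_frac t 0 *: _]/(dvr_frac t 0 * dvr_frac v j) dvr_fracM !lcoef_frac.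
by rewrite add0n addSn -[t]expr1 -(add1n (n + j)) dcoefXM.
Qed.

(** Only for integral tensors: multiplication by t shifts the terms t^-1 into degree 0. *)
Lemma slice0_tau (A : tensA R V) (m : M) v :
  slice 0 (to_loc (tau * A) *: pureM m (dvr_frac v 0)) = 0.
Proof.
elim/tensA_ind: A => [A B IH IH'|r v'].
  by rewrite mulrDr to_locD scalerDl sliceD IH IH' addr0.
rewrite pureAM to_loc_pure tensM_scale slice_pure mul1r.
rewrite -[X in lcoef 0 X]/(dvr_frac (t * v') 0 * dvr_frac v 0) dvr_fracM lcoef_frac.
by rewrite -mulrA -[t]expr1 dcoefXM_low // !scale0r.
Qed.

Lemma slice_inl n r (w : W) : slice n (to_loc (inl_alg V r) *: w) = r *: slice n w.
Proof. by rewrite to_loc_inl sliceZ. Qed.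

(** The embedding extends to Q_t by q / t^i |-> t^-i q, since t is invertible on M (x) V_t. *)
Lemma lattice_localizes (Q : lmodType (tensA R V)) (emb : Q -> W) :
    {morph emb : q q' / q + q'} -> (forall A q, emb (A *: q) = to_loc A *: emb q) ->
    (forall q, emb q = 0 -> q = 0) ->
    (forall m, exists q i, emb q = pureM m (dvr_frac (t ^+ i) 0)) ->
  lmod_iso (mod_loc Q) W.
Proof.
move=> embD embZ emb_inj emb_gen.
pose psi (y : mod_loc Q) : W :=
  pureA 1 (dvr_frac 1 (loc_repr y).2) *: emb (loc_repr y).1.
have psiE q i : psi (mod_frac q i) = pureA 1 (dvr_frac 1 i) *: emb q.
  rewrite /psi; have := loc_reprK (mod_frac q i).
  case: (loc_repr _) => q' i' /= /fracP[p E].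
  have {}E : tau ^+ (p + i) *: q' = tau ^+ (p + i') *: q by rewrite !inr_algX; exact: E.
  have := congr1 (fun q => pureA 1 (dvr_frac 1 (p + i + i')) *: emb q) E.
  rewrite !embZ !to_loc_tauX !scalerA !pureAM !mulr1 !dvr_fracM !mul1r.
  by rewrite !addn0 dvr_frac_shift addnAC dvr_frac_shift.
have psiD y y' : psi (y + y') = psi y + psi y'.
  elim/mod_loc_ind: y => q i; elim/mod_loc_ind: y' => q' j.
  rewrite [mod_frac q i + _](_ : _ = mod_frac (tau ^+ j *: q + tau ^+ i *: q') (i + j)); last first.
    by rewrite [LHS]fracD !inr_algX.
  rewrite !psiE embD !embZ scalerDr !to_loc_tauX !scalerA !pureAM !mulr1 !dvr_fracM !mul1r.
  by rewrite !addn0 dvr_frac_shift addnC dvr_frac_shift.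
have psiZ A y : psi (A *: y) = A *: psi y.
  elim/tensA_ind: A => [A B IH IH'|r x]; first by rewrite !scalerDl psiD IH IH'.
  elim/loc_ind: x => v i; elim/mod_loc_ind: y => q j.
  rewrite [pureA _ _ *: _]mod_loc_scale !psiE embZ to_loc_pure !scalerA !pureAM.
  by rewrite !dvr_fracM mul1r mulr1 mul1r mulr1 addn0.
have psi_lin : linear psi by move=> A y y'; rewrite psiD psiZ.
apply: (lmod_iso_of psi_lin).
- elim/mod_loc_ind => q i; rewrite psiE => /(congr1 (fun w => pureA 1 (dvr_frac (t ^+ i) 0) *: w)).
  rewrite scaler0 scalerA pureAM mulr1 dvr_fracM mulr1 add0n dvr_fracX.
  rewrite -[pureA 1 1]/(1 : tensA R Vt) scale1r => /emb_inj ->.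
  by apply/fracP; exists 0%N; rewrite !scaler0.
elim/tensM_ind => [|w w' [y <-] [y' <-]|m x].
- by exists 0; rewrite -(scale0r 0) psiZ scale0r.
- by exists (y + y'); rewrite psiD.
have [q [i Eq]] := emb_gen m; exists (pureA 1 (x * dvr_frac 1 i) *: mod_frac q 0).
rewrite psiZ psiE Eq !tensM_scale !scale1r; congr (Defs.pureM _ _).
rewrite -[LHS]/(x * dvr_frac 1 i * dvr_frac (t ^+ i) 0).
by rewrite -mulrA dvr_fracM mul1r addn0 dvr_fracX mulr1.
Qed.
End BaseChange.

(** * The degeneration of (x, y^a) to (x, y^(a + 2c)) *)

(** A module over the special fibre with two generators is determined by the relations between
    them. *)
Lemma fibre_iso (R : comNzRingType) (T : comPzRingType) (iota : {rmorphism R -> T}) (tau : T)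
    (Q : lmodType T) (U1 U2 : Q) (g f : R) :
    (forall q, exists r s q', q = iota r *: U1 + iota s *: U2 + tau *: q') ->
    (forall r s, r * g + s * f = 0 <-> exists q', iota r *: U1 + iota s *: U2 = tau *: q') ->
  lmod_iso (restrict iota (mod_elt tau Q)) (ideal [:: g; f]).
Proof.
move=> gen rel; apply: lmod_iso_sym.
have /choice[c Hc] : forall n : ideal [:: g; f], exists c : R * R,
    (ideal_val n : R) = c.1 * g + c.2 * f.
  by move=> n; have [r [s E]] := ideal2_val n; exists (r, s).
pose L (c : R * R) : Q := iota c.1 *: U1 + iota c.2 *: U2.
have L_lin a u v : L (a * u.1 + v.1, a * u.2 + v.2) = iota a *: L u + L v.
  by rewrite /L /= !rmorphD !rmorphM !scalerDl -!scalerA addrACA -scalerDr.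
have L_eq (u v : R * R) : u.1 * g + u.2 * f = v.1 * g + v.2 * f -> mod_pi tau (L u) = mod_pi tau (L v).
  move=> E; apply/mod_pi_eq.
  have [|q' Eq'] := proj1 (rel (u.1 - v.1) (u.2 - v.2)).
    by rewrite !mulrBl addrACA -opprD E subrr.
  by exists q'; rewrite -Eq' !rmorphB !scalerBl addrACA -opprD.
pose theta (n : ideal [:: g; f]) : restrict iota (mod_elt tau Q) := mod_pi tau (L (c n)).
have theta_lin : linear theta.
  move=> a m n; rewrite /theta.
  rewrite -[RHS]/(iota a *: mod_pi tau (L (c m)) + mod_pi tau (L (c n))) mod_piZ -mod_piD -L_lin.
  apply: L_eq; rewrite -Hc /=.
  rewrite -[LHS]/(a * (ideal_val m : R) + (ideal_val n : R)) (Hc m) (Hc n); ring.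
apply: (lmod_iso_of theta_lin).
- have pi0 : mod_pi tau (0 : Q) = 0 by apply: (addrI (mod_pi tau (0 : Q))); rewrite -mod_piD !addr0.
  move=> n E0; have /mod_pi_eq[q' E] : mod_pi tau (L (c n)) = mod_pi tau 0 by rewrite pi0; exact: E0.
  apply: ideal_val_inj; rewrite (Hc n); apply/rel; exists q'.
  by rewrite -E subr0.
move=> z; have [q ->] := mod_pi_surj z; have [r [s [q' ->]]] := gen q.
have Im : ideal_pred [:: g; f] (r * g + s * f) by apply/ideal2P; exists r, s.
exists (Ideal Im); rewrite /theta (L_eq _ (r, s)) -?Hc //.
by apply/mod_pi_eq; exists (- q'); rewrite /L /= opprD addrA subrr sub0r scalerN.
Qed.

Section Construction.
Variables (k : fieldType) (R : comAlgType k) (pi : {rmorphism powser 2 k -> R}).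
Hypothesis pi_surj : forall r, exists p, r = pi p.
Hypothesis pi_ker : forall p, pi p = 0 <-> exists c, p = c * pvar k (0 : 'I_2) ^+ 2.
Local Notation x := (pi (pvar k (0 : 'I_2))).
Local Notation y := (pi (pvar k (1 : 'I_2))).
Variables (a c : nat).
Local Notation b := (a + c.*2)%N.

Local Notation V := (powser1_dvr k).
Local Notation t := (dvr_unif V).
Local Notation Vt := (dvr_loc V).
Local Notation T := (tensA R V).
Local Notation iota := (inl_alg V).
Local Notation tau := (inr_alg R t).
Local Notation M := (ideal [:: x; y ^+ a]).
Local Notation W := (tensM M Vt^o).
Local Notation pureM := (@pureM k R Vt M Vt^o).
Local Notation WV := (restrict (@to_loc k R V) W).
Local Notation mx := (ideal2_fst x (y ^+ a)).
Local Notation my := (ideal2_snd x (y ^+ a)).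

Definition lat1 : WV := pureM my (dvr_frac (t ^+ 2) 0).
(** The exponents 1 and 0 are written out so that one rule multiplies all powers of t. *)
Definition lat2 : WV := pureM (y ^+ c *: my) (dvr_frac (t ^+ 1) 0) - pureM mx (dvr_frac (t ^+ 0) 0).
Definition lattice : lmodType T := span_mod [:: lat1; lat2].
Local Notation Q := lattice.
Definition lat_emb (q : Q) : W := span_val q.
Definition lat_U1 : Q := span2_fst lat1 lat2.
Definition lat_U2 : Q := span2_snd lat1 lat2.

Lemma lat_embD q q' : lat_emb (q + q') = lat_emb q + lat_emb q'.
Proof. by []. Qed.
Lemma lat_embB q q' : lat_emb (q - q') = lat_emb q - lat_emb q'.
Proof. by []. Qed.
Lemma lat_embZ A q : lat_emb (A *: q) = to_loc A *: lat_emb q.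
Proof. by []. Qed.
Lemma lat_emb_inj : injective lat_emb.
Proof. exact: span_val_inj. Qed.
Lemma lat_emb1 : lat_emb lat_U1 = pureM my (dvr_frac (t ^+ 2) 0).
Proof. by []. Qed.
Lemma lat_emb2 : lat_emb lat_U2 =
  pureM (y ^+ c *: my) (dvr_frac (t ^+ 1) 0) - pureM mx (dvr_frac (t ^+ 0) 0).
Proof. by []. Qed.

Lemma xmyE : x *: my = y ^+ a *: mx.
Proof. by apply: ideal_val_inj; exact: mulrC. Qed.
Lemma xmxE : x *: mx = 0.
Proof. by apply: ideal_val_inj; exact: (double_line_xx pi_ker). Qed.

Let tau_iota i r (q : Q) : tau ^+ i *: (iota r *: q) = iota r *: (tau ^+ i *: q).
Proof. by rewrite !scalerA mulrC. Qed.
Let embE := (lat_embB, lat_embD, lat_embZ).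
Let scaleE := (lat_emb1, lat_emb2, @scalerBr (tensA R Vt) W, scale_tauX_pureMX, scale_inl_pureM).

(** The two relations are the columns of the matrix of x: at t = 0 the first generator is killed
    by x, and x maps the second to y^b times the first. *)
Lemma lattice_rel1 : iota x *: lat_U1 =
  tau ^+ 1 *: (iota (y ^+ (a + c)) *: lat_U1 - iota (y ^+ a) *: (tau ^+ 1 *: lat_U2)).
Proof.
apply: lat_emb_inj; rewrite !embE !scaleE xmyE !scalerA -!exprD.
by rewrite opprB addrCA subrr addr0.
Qed.
Lemma lattice_rel2 : iota (y ^+ b) *: lat_U1 - iota x *: lat_U2 =
  tau ^+ 1 *: (iota (y ^+ (a + c)) *: lat_U2).
Proof.
apply: lat_emb_inj; rewrite !embE !scaleE xmxE pureM0l subr0.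
rewrite [x *: _]scalerA [x * _]mulrC -[(_ * x) *: _]scalerA xmyE !scalerA -!exprD.
by rewrite -addnA addnn [(c + a)%N]addnC.
Qed.

Lemma lattice_fin_gen : fin_gen Q.
Proof. exact: pair_fin_gen (@span2_gen _ _ _ _). Qed.

Lemma lattice_gen (q : Q) : exists r s q', q = iota r *: lat_U1 + iota s *: lat_U2 + tau *: q'.
Proof.
have [A [B ->]] := span2_gen q.
have [r [A' ->]] := tensA_expand A; have [s [B' ->]] := tensA_expand B.
exists r, s, (A' *: lat_U1 + B' *: lat_U2).
by rewrite !scalerDl scalerDr !scalerA addrACA.
Qed.

Lemma lattice_gen_M m : exists q i, lat_emb q = pureM m (dvr_frac (t ^+ i) 0).
Proof.
have [r [s ->]] := ideal2_gen m.
exists (iota r *: (iota (y ^+ c) *: (tau ^+ 1 *: lat_U1) - tau ^+ 2 *: lat_U2) + iota s *: lat_U1), 2%N.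
by rewrite !embE !scaleE opprB addrCA subrr addr0 -pureMDl.
Qed.

Lemma lattice_generic : lmod_iso (mod_loc Q) W.
Proof.
apply: (@lattice_localizes _ _ _ _ _ lat_emb) => //; last exact: lattice_gen_M.
by move=> q E; apply: lat_emb_inj.
Qed.

Lemma lattice_flat : flat (restrict (@inr_alg k R V) Q).
Proof.
apply: (@torsion_free_flat V); first exact: powser1_div_total.
move=> v q vq0; have [->|v0] := eqVneq v 0; [by left|right].
have [i [u [u' [Ev uu']]]] := powser1_factor v0.
have {}Ev : v = t ^+ i * (u : V) by exact: Ev.
have {}uu' : (u : V) * (u' : V) = 1 by exact: uu'.
have : to_loc (inr_alg R v) *: lat_emb q = 0.
  exact: (congr1 (fun z : restrict (@inr_alg k R V) Q => lat_emb z) vq0).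
rewrite to_loc_pure => /(congr1 (fun w => pureA (1 : R) (@dvr_frac k V u' i) *: w)).
rewrite scalerA pureAM mulr1 dvr_fracM addn0 Ev mulrCA [u' * u]mulrC uu' mulr1.
rewrite dvr_fracX -[pureA 1 1]/(1 : tensA R Vt) scale1r scaler0 => E.
exact: lat_emb_inj.
Qed.

Let y_regX i (r : R) : y ^+ i * r = 0 -> r = 0.
Proof.
elim: i r => [|i IHi] r; rewrite ?mul1r // exprSr -mulrA => /IHi.
exact: (double_line_y_reg pi_surj pi_ker).
Qed.

Let sliceE := (sliceB, sliceD, slice_inl, slice_pureX).

Let lattice_slice0_tau q : slice 0 (lat_emb (tau *: q)) = 0.
Proof.
have [A [B ->]] := span2_gen q; rewrite scalerDr !scalerA lat_embD !lat_embZ.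
rewrite -/lat_U1 -/lat_U2 lat_emb1 lat_emb2 scalerBr !sliceE.
by rewrite !slice0_tau subr0 addr0.
Qed.

Let lattice_slice0 q : exists s, slice 0 (lat_emb q) = s *: mx.
Proof.
have [r [s [q' ->]]] := lattice_gen q; exists (- s).
rewrite !lat_embD sliceD lattice_slice0_tau addr0 !lat_embZ lat_emb1 lat_emb2 !sliceE /=.
by rewrite scaler0 add0r sub0r scalerN scaleNr.
Qed.

(** The combination y^(a + c) slice 1 + x slice 2 maps r lat1 + s lat2 to y^a (r x + s y^b).
    Multiplying by t lowers the indices of the slices, so the vanishing of the shifted
    combination on Q shows that r x + s y^b depends only on the class modulo t. *)
Let lattice_slice01 q :
  y ^+ (a + c) *: slice 0 (lat_emb q) + x *: slice 1 (lat_emb q) = 0.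
Proof.
have [r [s [q' ->]]] := lattice_gen q; rewrite !lat_embD !sliceD lattice_slice0_tau addr0.
rewrite !lat_embZ lat_emb1 lat_emb2 slice_tau !sliceE /=.
have [s' ->] := lattice_slice0 q'.
apply: ideal_val_inj; transitivity (s' * (x * x)); last by rewrite (double_line_xx pi_ker) mulr0.
rewrite -[LHS]/(y ^+ (a + c) * (r * 0 + s * (0 - x)) +
  x * (r * 0 + s * (y ^+ c * y ^+ a - 0) + s' * x)) exprD; ring.
Qed.

(** The isomorphism sends lat1 to x and lat2 to y^b. *)
Lemma lattice_fibre : lmod_iso (restrict (@inl_alg k R V) (mod_elt tau Q)) (ideal [:: x; y ^+ b]).
Proof.
apply: (@fibre_iso _ _ _ _ _ lat_U1 lat_U2); first exact: lattice_gen.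
move=> r s; split.
  move=> rs0; have sx0 : s * x = 0.
    apply: (@y_regX b); have := double_line_xx pi_ker.
    move=> xx; transitivity (x * (r * x + s * y ^+ b) - r * (x * x)); first by ring.
    by rewrite rs0 xx !mulr0 subrr.
  have [s' Es] : exists s', s = s' * x.
    by apply: (double_line_ker_x pi_surj pi_ker); rewrite mulrC.
  have [d Ed] : exists d, r + s' * y ^+ b = d * x.
    apply: (double_line_ker_x pi_surj pi_ker).
    by rewrite -rs0 Es; ring.
  have -> : r = d * x - s' * y ^+ b by rewrite -Ed addrK.
  exists (iota d *: (iota (y ^+ (a + c)) *: lat_U1 - iota (y ^+ a) *: (tau ^+ 1 *: lat_U2))
     - iota s' *: (iota (y ^+ (a + c)) *: lat_U2)).
  rewrite -[tau in RHS]expr1 [RHS]scalerBr [_ *: (iota d *: _)]tau_iota [_ *: (iota s' *: _)]tau_iota -lattice_rel1 -lattice_rel2.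
  rewrite Es !(rmorphB, rmorphM) !scalerBl !scalerBr !scalerA opprB.
  by rewrite -!addrA; congr (_ + _); rewrite addrC.
move=> [q' /(congr1 lat_emb)]; rewrite !embE.
pose rho (w : W) : M := y ^+ (a + c) *: slice 1 w + x *: slice 2 w.
move=> /(congr1 rho); rewrite /rho !slice_tau lattice_slice01 lat_emb1 lat_emb2 !sliceE /=.
move=> /(congr1 (@ideal_val _ _)) E.
apply: (@y_regX a); rewrite -[RHS]E.
rewrite -[RHS]/(y ^+ (a + c) * (r * 0 + s * (y ^+ c * y ^+ a - 0)) +
  x * (r * (y ^+ a) + s * (0 - 0))) -addnn !exprD; ring.
Qed.

Lemma double_line_degenerates : degenerates M (ideal [:: x; y ^+ b]).
Proof.
exists V, Q; split; [exact: lattice_fin_gen | exact: lattice_flat | exact: lattice_fibre |].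
exact: lattice_generic.
Qed.
End Construction.

(** * The classification *)

Theorem theorem1p1 (k : closedFieldType) (char_k : 2%N \notin [pchar k]) :
  (let R := double_line k in
   let x : R := double_line_x k in
   let y : R := double_line_y k in
   forall a b : nat,
     degenerates (ideal [:: x; y ^+ a]) (ideal [:: x; y ^+ b])
       <-> ((a <= b)%N /\ (a = b %[mod 2])))
  /\
  (let R := crossing_planes k in
   let x : R := crossing_planes_x k in
   let y : R := crossing_planes_y k in
   let z : R := crossing_planes_z k in
   forall a b : nat, (a < b)%N ->
     ~ degenerates (ideal [:: x; z ^+ a]) (ideal [:: x; z ^+ b]) /\
     ~ degenerates (ideal [:: y; z ^+ a]) (ideal [:: y; z ^+ b])).
Proof.
split=> [R x y a b|R x y z a b lt_ab].
  pose pi : {rmorphism powser 2 k -> R} := quo_pi (double_line_proper k).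
  have pi_surj r : exists p, r = pi p by exact: quo_pi_surj.
  have pi_ker p : pi p = 0 <-> exists c, p = c * pvar k (0 : 'I_2) ^+ 2.
    exact: quo1_pi_eq0.
  split=> [/(degenerates_parity pi_surj pi_ker)[e ->]|[le_ab ab_mod]].
    by rewrite leq_addr -muln2 addnC modnMDl.
  have -> : b = (a + ((b - a)./2).*2)%N.
    lia.
  exact: (double_line_degenerates pi_surj pi_ker).
pose pi : {rmorphism powser 3 k -> R} := quo_pi (crossing_planes_proper k).
have pi_surj r : exists p, r = pi p by exact: quo_pi_surj.
have pi_ker p : pi p = 0 <-> exists c, p = c * (pvar k (0 : 'I_3) * pvar k (1 : 'I_3)).
  exact: quo1_pi_eq0.
have pi_ker' p : pi p = 0 <-> exists c, p = c * (pvar k (1 : 'I_3) * pvar k (0 : 'I_3)).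
  by rewrite pi_ker; split=> -[c ->]; exists c; rewrite [_ * pvar k 0]mulrC.
split; [apply: (@crossing_not_degenerates _ _ pi 0 1 2%:R) | apply: (@crossing_not_degenerates _ _ pi 1 0 2%:R)] => //.
Qed.
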